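(* Let $d\ge 1$ and let $K$ be a finite pure ridge-connected $d$-dimensional simplicial complex with at least two facets. Every positive eigenvalue $\lambda$ of the upper Laplacian $L^{\mathrm{up}}_{d-1}(K)$ satisfies \[ m_K(\lambda)\le 2\theta_d(K)+p_d(K). \qquad (\ast) \] If $(\theta_d(K),p_d(K))\ne(1,0)$, then every positive eigenvalue $\lambda$ of $L^{\mathrm{up}}_{d-1}(K)$ satisfies \[ m_K(\lambda)\le 2\theta_d(K)+p_d(K)-1. \] Moreover, the following are equivalent: (i) equality in $(\ast)$ is attained by some positive eigenvalue $\lambda$ of $L^{\mathrm{up}}_{d-1}(K)$; (ii) $K$ is a simplicial cycle; (iii) $(\theta_d(K),p_d(K))=(1,0)$.
   Context: A finite abstract simplicial complex $K$ is a collection of subsets (faces) of a finite vertex set closed under taking subsets; a face $\sigma$ has dimension $|\sigma|-1$. $K_i$ is the set of $i$-dimensional faces and $f_i(K)=|K_i|$. Facets are inclusion-maximal faces; $K$ is pure of dimension $d$ if every facet has dimension $d$. A ridge is a $(d-1)$-face. $K$ is ridge-connected if for every two facets $F,F'$ there are facets $F=F_0,F_1,\ldots,F_t=F'$ such that $F_{i-1}$ and $F_i$ share a ridge for each $i$. Choose an orientation of every face; $C_i(K;\mathbb{R})$ is the real vector space with the oriented $i$-faces as orthonormal basis, and $\partial_i:C_i(K;\mathbb{R})\to C_{i-1}(K;\mathbb{R})$, $\partial_i[v_0,\ldots,v_i]=\sum_{j=0}^i(-1)^j[v_0,\ldots,\widehat{v_j},\ldots,v_i]$, is the boundary operator, identified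 with its matrix. The upper Laplacian on ridges is $L_{d-1}^{\mathrm{up}}(K)=\partial_d\partial_d^{\mathsf T}$ (its spectrum does not depend on the orientations). For $\lambda>0$, $m_K(\lambda)$ is the multiplicity of $\lambda$ as an eigenvalue of $L_{d-1}^{\mathrm{up}}(K)$. A ridge is free if it is contained in exactly one facet, otherwise nonfree. A facet is pendant if exactly $d$ of its $d+1$ ridges are free; $p_d(K)$ is the number of pendant facets. Define $\theta_d(K)=d f_d(K)-f_{d-1}(K)+1$. A pure ridge-connected $d$-complex $K$ is a simplicial cycle if its facets can be cyclically ordered as $F_1,\ldots,F_m$ with $m\ge 3$, and there are distinct ridges $R_1,\ldots,R_m$ such that, with indices modulo $m$: (1) $R_i=F_i\cap F_{i+1}$; (2) $R_i$ is contained in exactly the two facets $F_i$ and $F_{i+1}$; (3) $R_1,\ldots,R_m$ are all the nonfree ridges of $K$. *)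

(* Defs.v *)
From HB Require Import structures.
From mathcomp Require Import all_boot all_order all_algebra.

Set Implicit Arguments.
Unset Strict Implicit.
Unset Printing Implicit Defensive.

Import Order.TTheory GRing.Theory Num.Theory.
Local Open Scope ring_scope.

Section Complexes.
Variable V : finType.
Implicit Types (K : {set {set V}}) (s t F : {set V}) (d i : nat).

Definition is_complex K : Prop :=
  forall s t, s \in K -> t \subset s -> t \in K.

Definition faces K i : {set {set V}} := [set s in K | #|s| == i.+1].

Definition facets K : {set {set V}} := [set F | maxset (mem K) F].

Definition pure K d : Prop := forall F, F \in facets K -> #|F| = d.+1.

(* The notions below involving ridges, the faces of dimension d.-1, are meant
   for d >= 1. *)
Definition ridges K d : {set {set V}} := faces K d.-1.

Definition share_ridge K d : rel {set V} := fun F F' =>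
  [&& F \in facets K, F' \in facets K &
      [exists r in ridges K d, (r \subset F) && (r \subset F')]].

Definition ridge_connected K d : Prop :=
  {in facets K &, forall F F', connect (share_ridge K d) F F'}.

Definition facets_through K s : {set {set V}} :=
  [set F in facets K | s \subset F].

Definition free_ridges K d : {set {set V}} :=
  [set r in ridges K d | #|facets_through K r| == 1%N].

Definition nonfree_ridges K d : {set {set V}} :=
  ridges K d :\: free_ridges K d.

Definition pendant_facets K d : {set {set V}} :=
  [set F in facets K | #|[set r in free_ridges K d | r \subset F]| == d].

Definition theta K d : int :=
  d%:Z * #|faces K d|%:Z - #|ridges K d|%:Z + 1.

(* [ordS k] is k + 1 modulo m.  The ambient assumption, that K is pure of
   dimension d and ridge-connected, is not repeated here. *)
Definition simplicial_cycle K d : Prop :=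
  exists m (F R : 'I_m -> {set V}),
    [/\ (3 <= m)%N,
        injective F /\ [set F k | k : 'I_m] = facets K,
        injective R /\ [set R k | k : 'I_m] = nonfree_ridges K d,
        forall k, R k = F k :&: F (ordS k)
      & forall k, facets_through K (R k) = [set F k; F (ordS k)]].

(* An orientation is given by a listing o s of the vertices of each face s;
   the oriented face [o s] depends on that listing only up to an even
   permutation. *)
Definition is_orientation K (o : {set V} -> seq V) : Prop :=
  forall s, s \in K -> perm_eq (o s) (enum s).

(* Number of pairs of entries of u which v lists in the opposite order. *)
Definition inversions (u v : seq V) : nat :=
  #|[set p : V * V | [&& p.1 \in u, p.2 \in u,
      (index p.1 u < index p.2 u)%N & (index p.2 v < index p.1 v)%N]]|.

End Complexes.

Section Laplacian.
Variables (R : realFieldType) (V : finType).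
Implicit Types (K : {set {set V}}) (o : {set V} -> seq V) (i : nat).

(* The coefficient of the oriented simplex [u] = [u_0, ..., u_i] (with distinct
   entries) on the basis vector [o t]: the sign of the permutation taking u to
   o t if t is the set of entries of u, and 0 otherwise. *)
Definition oriented_coef o (u : seq V) (t : {set V}) : R :=
  if [set x in u] == t then (-1) ^+ inversions u (o t) else 0.

Definition boundary_coef o (t s : {set V}) : R :=
  \sum_(j < size (o s))
     (-1) ^+ j * oriented_coef o (take j (o s) ++ drop j.+1 (o s)) t.

(* The matrix of the boundary operator from (i+1)-chains to i-chains. *)
Definition boundary o K i : 'M[R]_(#|faces K i|, #|faces K i.+1|) :=
  \matrix_(a, b) boundary_coef o (enum_val a) (enum_val b).

Definition up_laplacian o K i : 'M[R]_(#|faces K i|) :=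
  boundary o K i *m (boundary o K i)^T.

(* [eigenspace] is made of row vectors, which is harmless as the Laplacian is
   symmetric. *)
Definition multiplicity o K i (lambda : R) : nat :=
  \rank (eigenspace (up_laplacian o K i) lambda).

End Laplacian.

(* Main.v *)
Require Import Defs.
From HB Require Import structures.
From mathcomp Require Import all_boot all_order all_algebra.
From mathcomp Require Import zify ring lra.
From mathcomp Require Import reals trigo.

Set Implicit Arguments.
Unset Strict Implicit.
Unset Printing Implicit Defensive.

(** Let [B] be the boundary matrix, ridges by facets. For [lambda > 0] and an
eigenvector [y] of [B *m B^T], put [x = y *m B]; then [lambda y = x *m B^T], and
the equation reads, at each ridge, as a relation between its value and those of
the facets through it, and at each facet, as a relation between its value and
those of its ridges. The value at a free ridge is a multiple of the value at its
facet, so free ridges can be eliminated, and the eigenvector is described by its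
values on the bipartite graph of the facets and the nonfree ridges. This graph is
connected, its cyclomatic number is [theta] ([theta_graph]), and its leaves are the
pendant facets ([card_leaves]).

If a value is zero at a vertex and at all its neighbours but one, then it is
zero at the last one ([zeros_forcing_closed]). So the multiplicity is at most the
size of a zero forcing set of the graph ([multiplicity_le_forcing]). Take a
spanning tree: the leaves of the graph together with the ends of the edges outside
the tree force everything, from the leaves of the tree to its root. This gives
[2 * theta + p]. One vertex can be saved unless the graph is a cycle
([zero_forcing_lt]): a leaf taken as root if there is one; otherwise, if some
degree exceeds 2, some vertex of degree at least 3 lies on a cycle
([heavy_cycle_edge_exists]), and a tree rooted there that avoids an edge of the
cycle at the root does it ([zero_forcing_lt_heavy]).

If [theta = 1] and [p = 0], all the degrees of the graph are 2 and the graph is a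
cycle, which alternates between the facets and the nonfree ridges of a simplicial
cycle ([two_regular_cycle]); there are at least three facets, as two facets share
at most one ridge. Conversely, counting ridges in a simplicial cycle gives
[theta = 1] and [p = 0] ([cycle_theta_pendant]). On a simplicial cycle [B^T *m B] is [d + 1] plus a signed adjacency matrix of a cycle of
length at least 3, whose eigenvalue [2 cos phi] has the two independent
eigenvectors given by cosines and sines ([signed_cycle_eigenvectors]), so that the
value 2 of the bound is attained. *)

(** * Zero forcing in connected graphs *)

Section SpanningTree.
Variable X : finType.

Definition connected_rel (g : rel X) := forall x y, connect g x y.

(** The rank [rk] decreases towards the root: this rules out cycles and provides
the induction. Making the root its own parent lets [par] be iterated. *)
Definition spanning_tree (e : rel X) r (par : X -> X) (rk : X -> nat) :=
  par r = r /\ forall x, x != r -> e x (par x) /\ rk (par x) < rk x.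

(** Breadth-first search: the rank is the distance to the root. *)
Lemma tree_exists (e : rel X) r : symmetric e -> connected_rel e ->
  exists par rk, spanning_tree e r par rk.
Proof.
move=> esym conn.
pose P x k := [exists p : k.-tuple X, path e r p && (last r p == x)].
have exP x : exists k, P x k.
  have /connectP[p pp ->] := conn r x.
  by exists (size p); apply/existsP; exists (in_tuple p); rewrite pp eqxx.
pose rk x := ex_minn (exP x).
have H x : exists y, if x == r then y == r else e x y && (rk y < rk x).
  case: (eqVneq x r) => [_|xr]; first by exists r.
  rewrite /rk; case: ex_minnP => k /existsP[p /andP[pp /eqP lp]] _.
  case/lastP: {p}(val p) (size_tuple p) pp lp => [|q z] /=.
    by move=> _ _ E; rewrite E eqxx in xr.
  rewrite size_rcons last_rcons rcons_path => sk /andP[pq eqz] zx.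
  exists (last r q); rewrite esym -zx eqz /=.
  case: ex_minnP => j _ /(_ (size q)); rewrite -sk ltnS; apply.
  by apply/existsP; exists (in_tuple q); rewrite pq eqxx.
have [par parP] := fin_all_exists H; exists par, rk; split.
  by have := parP r; rewrite eqxx => /eqP.
by move=> x /negPf xr; have := parP x; rewrite xr => /andP.
Qed.

End SpanningTree.

Section ZeroForcing.
Variables (X : finType) (e : rel X).

Definition deg x := #|[set y | e x y]|.
Definition leaves := [set x | deg x == 1].

(** The zero set of a vector in the kernel of a symmetric matrix whose
off-diagonal support is the graph is closed in this sense: at a vertex [c] where
the vector vanishes, the equation of row [c] involves only the neighbours of
[c], so that a single neighbour cannot carry a nonzero value. *)
Definition forcing_closed (Z : {set X}) := forall c x,
  c \in Z -> e c x -> (forall y, e c y -> y != x -> y \in Z) -> x \in Z.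

Definition zero_forcing (S : {set X}) := forall Z,
  forcing_closed Z -> S \subset Z -> forall x, x \in Z.

Definition tree_edge r (par : X -> X) x y :=
  ((x != r) && (y == par x)) || ((y != r) && (x == par y)).

(** Ordered pairs rather than edges: they are counted by sums of degrees. *)
Definition cotree r par x y := e x y && ~~ tree_edge r par x y.

Definition cotree_ends r par := [set x | [exists y, cotree r par x y]].

Hypothesis esym : symmetric e.
Hypothesis eirr : irreflexive e.

Lemma degE x : deg x = \sum_y e x y.
Proof. by rewrite /deg cardsE -sum1_card big_mkcond. Qed.

Lemma tree_edge_sym r par x y : tree_edge r par x y = tree_edge r par y x.
Proof. by rewrite /tree_edge orbC. Qed.

Lemma cotree_sym r par x y : cotree r par x y = cotree r par y x.
Proof. by rewrite /cotree esym tree_edge_sym. Qed.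

Section Tree.
Variables (r : X) (par : X -> X) (rk : X -> nat).
Hypothesis tree : spanning_tree e r par rk.

Lemma tree_edge_split x y :
  (tree_edge r par x y : nat) =
  (x != r) && (y == par x) + (y != r) && (x == par y).
Proof.
rewrite /tree_edge; case: (boolP (_ && _)) => //= /andP[xr /eqP ->].
case: (boolP (_ && _)) => //= /andP[pr /eqP xp].
have [_ h1] := tree.2 _ xr; have [_ h2] := tree.2 _ pr.
by rewrite -xp in h2; have := ltn_trans h1 h2; rewrite ltnn.
Qed.

Lemma tree_edge_in x y : tree_edge r par x y -> e x y.
Proof.
case/orP=> /andP[xr /eqP ->]; first by case: (tree.2 _ xr).
by rewrite esym; case: (tree.2 _ xr).
Qed.

Lemma sum_tree_edge : \sum_x \sum_y tree_edge r par x y + 2 = 2 * #|X|.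
Proof.
have H : \sum_x (x != r) = #|X|.-1.
  rewrite -(cardC1 r) -sum1_card [RHS]big_mkcond /=; apply: eq_bigr => x _.
  by rewrite inE; case: eqP.
have H1 : \sum_x \sum_y ((x != r) && (y == par x)) = #|X|.-1.
  rewrite -H; apply: eq_bigr => x _.
  rewrite (bigD1 (par x)) //= eqxx andbT big1 ?addn0 //.
  by move=> y /negPf ->; rewrite andbF.
under eq_bigr do (under eq_bigr do rewrite tree_edge_split; rewrite big_split /=).
rewrite big_split /= H1 exchange_big /= H1.
have double_pred n : 0 < n -> n.-1 + n.-1 + 2 = 2 * n by lia.
by apply: double_pred; apply/card_gt0P; exists r.
Qed.

(** A tree on [n] vertices has [n - 1] edges, so that twice the cyclomatic number
is the number of ordered pairs outside the tree. *)
Lemma sum_cotree :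
  \sum_x \sum_y cotree r par x y + 2 * #|X| = \sum_x deg x + 2.
Proof.
rewrite -sum_tree_edge addnA -big_split /=; congr (_ + 2).
apply: eq_bigr => x _; rewrite degE -big_split /=; apply: eq_bigr => y _.
rewrite /cotree; case: (boolP (tree_edge _ _ _ _)) => [/tree_edge_in ->|] //=.
by case: (e x y).
Qed.

Lemma card_cotree_ends (P : pred X) :
  #|[set x in cotree_ends r par | P x]| <=
    \sum_(x | P x) \sum_y cotree r par x y.
Proof.
rewrite -sum1_card big_mkcond [leqRHS]big_mkcond leq_sum // => x _.
rewrite !inE; case: (P x); rewrite ?andbF ?andbT //.
by case: ifP => // /existsP[y xy]; rewrite (bigD1 y) //= xy.
Qed.

Lemma card_all_cotree_ends : #|cotree_ends r par| + 2 * #|X| <= \sum_x deg x + 2.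
Proof.
rewrite -sum_cotree leq_add2r.
apply: leq_trans (card_cotree_ends xpredT); rewrite subset_leq_card //.
by apply/subsetP => x; rewrite [in X in _ -> X]inE andbT.
Qed.

(** Zeros propagate from the leaves of the tree to its root: at a child [c] of [x],
all the neighbours other than [x] are children of [c], where the value is zero by
induction, or the far ends of edges outside the tree. The predicate [Q] restricts
the argument to a union of branches. *)
Lemma tree_forcing (Z : {set X}) (Q : pred X) :
  forcing_closed Z ->
  (forall x, x != r -> Q (par x) -> Q x) ->
  (forall x, Q x -> (forall y, y != r -> par y != x) -> x \in Z) ->
  (forall x y, Q x -> cotree r par x y -> y \in Z) ->
  forall x, Q x -> x \in Z.
Proof.
move=> Zf Qpar Qleaf Qcot.
have [N] := ubnP (\max_x rk x).
have bnd x : rk x <= \max_x rk x by apply: leq_bigmax.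
move: (\max_x rk x) bnd => M bnd _ {N}.
move=> x; have [k] := ubnP (M - rk x); elim: k x => // k IH x xk Qx.
case: (boolP [exists y, (y != r) && (par y == x)]) => [/existsP[c /andP[cr /eqP cx]]|].
  have [ecx rkc] := tree.2 _ cr; rewrite cx in ecx rkc.
  have Qc : Q c by apply: Qpar; rewrite // cx.
  have := bnd c => bc.
  apply: (Zf c) => //; first by apply: IH => //; lia.
  move=> y ecy yx; case: (boolP (tree_edge r par c y)) => [|nt]; last first.
    by apply: Qcot Qc _; rewrite /cotree ecy.
  case/orP=> /andP[yr /eqP E]; first by rewrite E cx eqxx in yx.
  have [_ rky] := tree.2 _ yr; rewrite -E in rky.
  have := bnd y => bY.
  apply: IH; first lia.
  by apply: Qpar; rewrite // -E.
rewrite negb_exists => /forallP H; apply: Qleaf => // y yr.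
by have := H y; rewrite yr.
Qed.

(** A leaf of the tree either is a leaf of the graph or has lost an edge. *)
Lemma childless_end x : (forall y, y != r -> par y != x) ->
  0 < deg x -> (x != r -> deg x != 1) -> x \in cotree_ends r par.
Proof.
move=> nc d0 d1; rewrite inE.
case: (eqVneq x r) => [xr|xr].
  move: d0 => /card_gt0P[y]; rewrite inE => exy; apply/existsP; exists y.
  rewrite /cotree exy /tree_edge xr eqxx /=; apply/negP=> /andP[yr /eqP E].
  by have := nc _ yr; rewrite -E xr eqxx.
have [ep _] := tree.2 _ xr.
have : 1 < deg x by have := d1 xr; lia.
rewrite /deg (cardsD1 (par x)) inE ep ltnS => /card_gt0P[y].
rewrite !inE => /andP[yp exy]; apply/existsP; exists y.
rewrite /cotree exy /tree_edge (negPf yp) andbF /=; apply/negP=> /andP[yr /eqP E].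
by have := nc _ yr; rewrite -E eqxx.
Qed.

Lemma root_ancestor x : fconnect par x r.
Proof.
have [k] := ubnP (rk x); elim: k x => // k IH x xk.
case: (eqVneq x r) => [->|xr]; first exact: connect0.
have [_ rkx] := tree.2 _ xr.
apply: connect_trans (connect1 _) (IH (par x) _); [exact: eqxx | lia].
Qed.

Lemma tree_connected (g : rel X) : (forall x, x != r -> g x (par x)) ->
  symmetric g -> connected_rel g.
Proof.
move=> gp gs.
have c x : connect g x r.
  apply: connect_sub (root_ancestor x) => {}x _ /eqP <-.
  by case: (eqVneq x r) => [->|/gp]; [rewrite tree.1 connect0 | apply: connect1].
move=> x y; apply: connect_trans (c x) _.
by rewrite (sym_connect_sym gs).
Qed.

End Tree.

Hypothesis conn : connected_rel e.
Hypothesis card2 : 1 < #|X|.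

Lemma deg_gt0 x : 0 < deg x.
Proof.
have [y yx] : exists y, y != x.
  have : 0 < #|predC1 x| by rewrite cardC1; lia.
  by case/card_gt0P=> y; rewrite inE; exists y.
have /connectP[[|z p] /=] := conn x y; first by move=> _ E; rewrite E eqxx in yx.
by move=> /andP[exz _] _; apply/card_gt0P; exists z; rewrite inE.
Qed.

Lemma deg_gt1 : leaves = set0 -> forall x, 1 < deg x.
Proof.
move=> nl x; have := deg_gt0 x; have : x \notin leaves by rewrite nl inE.
by rewrite inE; case: (deg x) => [|[|]].
Qed.

Lemma forcing_leaves_cotree r par rk (S : {set X}) : spanning_tree e r par rk ->
  (leaves :\ r) :|: cotree_ends r par \subset S -> zero_forcing S.
Proof.
move=> tree; rewrite subUset => /andP[lS cS] Z Zf SZ x.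
apply: (tree_forcing tree (Q := xpredT)) => // {}x; last first.
  move=> y _ xy; apply: (subsetP SZ); apply: (subsetP cS); rewrite inE.
  by apply/existsP; exists x; rewrite cotree_sym.
move=> _ nc; apply: (subsetP SZ).
case: (boolP (x \in leaves :\ r)) => [|]; first exact: (subsetP lS).
rewrite !inE => h; apply: (subsetP cS); apply: (childless_end tree nc) (deg_gt0 x) _.
by move=> xr; rewrite xr in h.
Qed.

Lemma zero_forcing_leq : exists2 S, zero_forcing S &
  #|S| + 2 * #|X| <= \sum_x deg x + 2 + #|leaves|.
Proof.
have /card_gt0P[r _] : 0 < #|X| by lia.
have [par [rk tree]] := tree_exists r esym conn.
exists (leaves :|: cotree_ends r par).
  by apply: (forcing_leaves_cotree tree); rewrite setSU // subD1set.
have := card_all_cotree_ends tree.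
have := leq_of_leqif (leq_card_setU leaves (cotree_ends r par)); lia.
Qed.

(** A leaf of the graph taken as root is reached last and need not be in the
forcing set. *)
Lemma zero_forcing_lt_leaves : leaves != set0 -> exists2 S, zero_forcing S &
  #|S| + 2 * #|X| < \sum_x deg x + 2 + #|leaves|.
Proof.
case/set0Pn=> r lr.
have [par [rk tree]] := tree_exists r esym conn.
exists ((leaves :\ r) :|: cotree_ends r par).
  exact: (forcing_leaves_cotree tree).
have := card_all_cotree_ends tree.
have := leq_of_leqif (leq_card_setU (leaves :\ r) (cotree_ends r par)).
have := cardsD1 r leaves; rewrite lr; lia.
Qed.

Definition remove_edge u v x y := [&& e x y, (x, y) != (u, v) & (x, y) != (v, u)].

Lemma remove_edge_sym u v : symmetric (remove_edge u v).
Proof.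
move=> x y; rewrite /remove_edge esym; congr andb; rewrite !xpair_eqE.
by rewrite andbC; congr (~~ _ && ~~ _); rewrite andbC.
Qed.

Lemma remove_edgeC u v : remove_edge u v =2 remove_edge v u.
Proof. by move=> x y; rewrite /remove_edge [X in _ && X]andbC. Qed.

(** An edge is on a cycle exactly when removing it keeps the graph connected. *)
Definition cycle_edge u v := e u v /\ connected_rel (remove_edge u v).

Lemma cycle_edge_sym u v : cycle_edge u v -> cycle_edge v u.
Proof.
case=> euv c; split; first by rewrite esym.
by move=> x y; rewrite (eq_connect (remove_edgeC v u)).
Qed.

Lemma cycle_edge_exists : 2 * #|X| <= \sum_x deg x -> exists u v, cycle_edge u v.
Proof.
move=> big.
have /card_gt0P[r _] : 0 < #|X| by lia.
have [par [rk tree]] := tree_exists r esym conn.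
have : 0 < \sum_x \sum_y cotree r par x y by have := sum_cotree tree; lia.
rewrite lt0n sum_nat_eq0 negb_forall => /existsP[u] /=.
rewrite sum_nat_eq0 negb_forall => /existsP[v] /=.
rewrite eqb0 negbK => uv; exists u, v; split; first by case/andP: uv.
apply: (tree_connected tree); last exact: remove_edge_sym.
move=> x xr; have [ep _] := tree.2 _ xr; rewrite /remove_edge ep /=.
case/andP: (uv) => _ nt.
apply/andP; split; apply/eqP => -[E1 E2]; case/negP: nt.
  by rewrite /tree_edge -E1 -E2 xr eqxx.
by rewrite /tree_edge -E1 -E2 xr eqxx orbT.
Qed.

(** A cycle that enters a vertex of degree 2 by one edge leaves it by the other.
With [y] and [w] the two neighbours of [x], a path from [y] to [x] avoiding the
edge [xy] ends with [w], [x]; its part before [x] bypasses the edge [xw]. *)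
Lemma cycle_edge_next x y w : deg x = 2 -> e x w -> w != y ->
  cycle_edge x y -> cycle_edge x w.
Proof.
move=> dx exw wy [exy c]; split=> //.
have nbx z : e x z -> z != y -> z = w.
  move=> exz zy; apply/eqP; apply/negPn/negP=> zw.
  move/eqP: dx; rewrite /deg (cardsD1 y) (cardsD1 w) (cardsD1 z) !inE.
  by rewrite exy exw exz wy zy zw.
have xNy : x != y by apply/eqP => E; rewrite E eirr in exy.
have xNw : x != w by apply/eqP => E; rewrite E eirr in exw.
have cyw : connect (remove_edge x w) y w.
  have /connectP[p0 pp0 lp0] := c y x.
  case/shortenP: pp0 lp0 => p pp up _ lp; move: pp up lp.
  case/lastP: p => [_ _ E|q z]; first by rewrite E eqxx in xNy.
  rewrite last_rcons rcons_path -rcons_cons rcons_uniq => /andP[pq lx].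
  move=> /andP[zq _] xz; rewrite -xz in zq lx => {z xz}.
  have qw : last y q = w.
    case/and3P: lx => elx _ nlx; apply: nbx; first by rewrite esym.
    by apply: contraNneq nlx => ->.
  rewrite -[X in connect _ _ X]qw; apply/connectP; exists q => //.
  have {}pq : path e y q by apply: sub_path pq => a b /and3P[].
  elim: q (y) pq zq {lx qw} => //= z q IH t /andP[etz pq].
  rewrite inE negb_or => /andP[xt xzq]; apply/andP; split; last exact: IH.
  rewrite /remove_edge etz !xpair_eqE /=.
  move: xzq; rewrite inE negb_or => /andP[xz _].
  by rewrite (eq_sym t x) (negPf xt) (eq_sym z x) (negPf xz) andbF.
have cxw : connect (remove_edge x w) x w.
  apply: connect_trans _ cyw; apply: connect1.
  by rewrite /remove_edge exy !xpair_eqE eqxx /= eq_sym wy (negPf xNw).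
move=> a b; apply: connect_sub (conn a b) => {}a {}b eab.
case: (boolP (remove_edge x w a b)) => [|]; first exact: connect1.
rewrite /remove_edge eab /= negb_and !negbK !xpair_eqE.
case/orP=> /andP[/eqP -> /eqP ->] //.
by rewrite (sym_connect_sym (remove_edge_sym x w)).
Qed.

Lemma heavy_vertex_exists : 2 * #|X| < \sum_x deg x -> exists x, 2 < deg x.
Proof.
move=> big; apply/existsP; apply: contraLR big; rewrite negb_exists => /forallP H.
rewrite -leqNgt mulnC -sum_nat_const leq_sum // => x _.
by rewrite leqNgt H.
Qed.

(** Starting from an edge on a cycle, walk towards a vertex of degree at least 3.
As long as the vertices met have degree 2, [cycle_edge_next] shows that the edges
followed are on cycles too; so the first vertex of degree at least 3 is the end
of such an edge. *)
Lemma heavy_cycle_edge_exists : leaves = set0 -> 2 * #|X| < \sum_x deg x ->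
  exists u v, cycle_edge u v /\ 2 < deg v.
Proof.
move=> nl big.
have [t ht] := heavy_vertex_exists big.
have [u [v uv]] := cycle_edge_exists (ltnW big).
have /connectP[p pp E] := conn u t; rewrite E in ht; move: {t E big} ht.
elim: p u v uv pp => [|w p IH] u v uv /=.
  by move=> _ h; exists v, u; split=> //; apply: cycle_edge_sym.
case/andP=> euw pw hl.
case: (ltnP 2 (deg u)) => [|d2]; first by exists v, u; split=> //; apply: cycle_edge_sym.
have du : deg u = 2 by apply/eqP; rewrite eqn_leq d2 deg_gt1.
apply: (IH w u) => //; apply: cycle_edge_sym.
by case: (eqVneq w v) => [->//|wv]; apply: cycle_edge_next du euw wv uv.
Qed.

(** Take a spanning tree rooted at [v] that avoids an edge [uv] of a cycle, where
[v] has degree at least 3. If [v] has another edge outside the tree, two ordered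
pairs outside the tree share their end [v] and the count improves by one. If
[uv] is the only such edge at [v], then [v] can be left out of the forcing set:
a branch at [v] that does not contain [u] involves only edges whose ends are
known zeros, and it forces [v]; then all the ends are zeros and the
usual propagation applies. *)
Lemma zero_forcing_lt_heavy : leaves = set0 -> 2 * #|X| < \sum_x deg x ->
  exists2 S, zero_forcing S & #|S| + 2 * #|X| < \sum_x deg x + 2.
Proof.
move=> nl big.
have [u [v [[euv cuv] dv]]] := heavy_cycle_edge_exists nl big.
have [par [rk [par0 tree']]] := tree_exists v (remove_edge_sym u v) cuv.
have tree : spanning_tree e v par rk.
  by split=> // x xv; have [/and3P[]] := tree' x xv.
have cvu : cotree v par v u.
  rewrite /cotree esym euv /tree_edge eqxx /=; apply/negP=> /andP[uv /eqP E].
  by have [/and3P[_]] := tree' u uv; rewrite -E eqxx.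
have := sum_cotree tree; rewrite (bigD1 v) //= => sumE.
have ends_le :
    #|cotree_ends v par :\ v| <= \sum_(x | x != v) \sum_y cotree v par x y.
  rewrite (_ : _ :\ v = [set x in cotree_ends v par | x != v]).
    exact: card_cotree_ends.
  by apply/setP => x; rewrite !inE andbC.
move: (\sum_(x | x != v) _) ends_le sumE => rest ends_le sumE.
have : 0 < \sum_y cotree v par v y by rewrite (bigD1 u) //= cvu.
rewrite leq_eqVlt => /orP[/eqP one|two]; last first.
  exists (cotree_ends v par).
    by apply: (forcing_leaves_cotree tree); rewrite nl set0D set0U.
  have := cardsD1 v (cotree_ends v par); lia.
exists (cotree_ends v par :\ v); last lia.
have only_u y : cotree v par v y -> y = u.
  move=> vy; apply/eqP/negPn/negP => yu; move: one.
  by rewrite (bigD1 u) //= cvu (bigD1 y) //= vy.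
move=> Z Zf SZ.
(* Off the branch of u, no edge outside the tree ends in v. *)
pose Q x := ~~ fconnect par u x.
have Qpar x : Q (par x) -> Q x.
  apply: contra => ux; apply: connect_trans ux (connect1 _); exact: eqxx.
have SZ' x : x != v -> x \in cotree_ends v par -> x \in Z.
  by move=> xv xc; apply: (subsetP SZ); rewrite in_setD1 xv.
have end_r x y : cotree v par x y -> y \in cotree_ends v par.
  by move=> xy; rewrite inE; apply/existsP; exists x; rewrite cotree_sym.
have QZ x : Q x -> x \in Z.
  apply: (tree_forcing tree Zf (Q := Q)) => {x} [x _|x Qx nc|x y Qx xy]; first exact: Qpar.
    apply: SZ'; first by apply: contraNneq Qx => ->; apply: (root_ancestor tree).
    have d2 := deg_gt1 nl x.
    by apply: (childless_end tree nc) => [|_]; rewrite ?gtn_eqF // ltnW.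
  apply: SZ'; last exact: end_r xy.
  apply: contraNneq Qx => yv; rewrite yv cotree_sym in xy.
  by rewrite (only_u _ xy) connect0.
have vZ : v \in Z.
  (* At most one child of v is an ancestor of u, because the ancestors of u form
     a chain on which v comes last; v has a further child, and that one is not
     an ancestor of u. *)
  pose ch := [set c | (c != v) && (par c == v)].
  have ch2 : 1 < #|ch|.
    have /subset_leq_card : [set y | e v y] :\ u \subset ch.
      apply/subsetP => c; rewrite !inE => /andP[cu evc].
      have : ~~ cotree v par v c by apply: contraNN cu => /only_u ->.
      by rewrite /cotree evc /= negbK /tree_edge eqxx /= [v == _]eq_sym.
    have := cardsD1 u [set y | e v y]; rewrite inE esym euv -/(deg v); lia.
  have anc_ch c1 c2 : c1 \in ch -> c2 \in ch ->
      fconnect par u c1 -> fconnect par u c2 -> c1 = c2.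
    rewrite !inE => /andP[n1 /eqP p1] /andP[n2 /eqP p2] /iter_findex E1 /iter_findex E2.
    have iterv k : iter k par v = v by elim: k => //= k ->.
    have key i j a b : iter i par u = a -> iter j par u = b ->
        par a = v -> b != v -> j <= i.
      move=> Ea Eb pa bv; rewrite leqNgt; apply: contra bv => ij.
      by rewrite -Eb -(subnK ij) iterD iterS Ea pa iterv.
    have le1 := key _ _ _ _ E1 E2 p1 n2; have le2 := key _ _ _ _ E2 E1 p2 n1.
    by rewrite -E1 -E2; congr (iter _ _ _); apply/eqP; rewrite eqn_leq le1 le2.
  have [c cch Qc] : exists2 c, c \in ch & Q c.
    case/card_gt1P: ch2 => c1 [c2 [h1 h2 n12]].
    case: (boolP (Q c1)) => [|q1]; first by exists c1.
    case: (boolP (Q c2)) => [|q2]; first by exists c2.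
    by move: n12; rewrite (anc_ch c1 c2) ?eqxx //; apply: negbNE.
  move: cch; rewrite inE => /andP[cv /eqP pc].
  have [ecv _] := tree.2 _ cv; rewrite pc in ecv.
  apply: (Zf c) => //; first exact: QZ.
  move=> y ecy yv; case: (boolP (tree_edge v par c y)) => [/orP[]/andP[]|nt].
  - by move=> _ /eqP E; rewrite E pc eqxx in yv.
  - by move=> _ /eqP E; apply/QZ/Qpar; rewrite -E.
  by apply: SZ' => //; apply: (end_r c); rewrite /cotree ecy.
apply: (forcing_leaves_cotree tree (S := v |: cotree_ends v par)) Zf _ => [|].
  by rewrite nl set0D set0U subsetUr.
apply/subsetP => x; rewrite in_setU1 => /orP[/eqP -> //|xc].
by case: (eqVneq x v) => [->|xv] //; apply: SZ'.
Qed.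

Lemma zero_forcing_lt : leaves != set0 \/ \sum_x deg x != 2 * #|X| ->
  exists2 S, zero_forcing S & #|S| + 2 * #|X| < \sum_x deg x + 2 + #|leaves|.
Proof.
case: (eqVneq leaves set0) => [nl|nl _]; last exact: zero_forcing_lt_leaves.
case=> // neq; rewrite nl cards0 addn0; apply: zero_forcing_lt_heavy => //.
rewrite ltn_neqAle eq_sym neq /= mulnC -sum_nat_const leq_sum // => x _.
exact: deg_gt1.
Qed.

Lemma deg_eq2 : leaves = set0 -> \sum_x deg x = 2 * #|X| ->
  forall x, deg x = 2.
Proof.
move=> nl sumE x.
have [//|H] := eqVneq (deg x) 2.
have : \sum_(y : X) 2 < \sum_y deg y.
  rewrite (bigD1 x) // [leqRHS](bigD1 x) //= -addSn leq_add ?leq_sum //.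
  by rewrite ltn_neqAle eq_sym H deg_gt1.
  by move=> y _; apply: deg_gt1.
by rewrite sum_nat_const sumE mulnC ltnn.
Qed.

End ZeroForcing.

(** * The graph of facets and nonfree ridges *)

Lemma card_set_in (T : finType) (A : {set T}) (P : pred T) :
  #|[set x in A | P x]| = \sum_(x in A) P x.
Proof.
rewrite -sum1_card big_mkcond [RHS]big_mkcond; apply: eq_bigr => x _.
by rewrite inE; case: (x \in A); case: (P x).
Qed.

Section IncidenceGraph.
Variables (V : finType) (K : {set {set V}}) (d : nat).
Implicit Types (F G r s t : {set V}).
Hypotheses (d_gt0 : 0 < d) (cplxK : is_complex K) (pureK : pure K d).

Lemma facets_faces : facets K = faces K d.
Proof.
apply/setP => F; rewrite !inE; apply/idP/andP => [mF|[FK /eqP cF]].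
  split; first by case/maxsetP: (mF).
  by rewrite pureK // inE.
have [G mG FG] := maxset_exists (P := mem K) FK.
have cG : #|G| = d.+1 by rewrite pureK // inE.
suff -> : F = G by [].
by apply/eqP; rewrite eqEcard FG cF cG /=.
Qed.

Lemma facetP F : reflect (F \in K /\ #|F| = d.+1) (F \in facets K).
Proof. by rewrite facets_faces inE; apply: (iffP andP) => -[? /eqP]. Qed.

Lemma ridgeP r : reflect (r \in K /\ #|r| = d) (r \in ridges K d).
Proof. by rewrite inE prednK //; apply: (iffP andP) => -[? /eqP]. Qed.

Lemma facet_over s : s \in K -> exists2 F, F \in facets K & s \subset F.
Proof.
by move=> sK; have [F mF sF] := maxset_exists (P := mem K) sK; exists F; rewrite ?inE.
Qed.

Lemma ridge_in_facet F r : F \in facets K -> r \subset F -> #|r| = d ->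
  r \in ridges K d.
Proof. by case/facetP=> FK _ rF cr; apply/ridgeP; split=> //; apply: cplxK FK rF. Qed.

Lemma facet_not_ridge F : F \in facets K -> F \notin ridges K d.
Proof. by case/facetP=> _ cF; apply/negP => /ridgeP[_]; lia. Qed.

Lemma card_ridges_in F : F \in facets K ->
  #|[set r in ridges K d | r \subset F]| = d.+1.
Proof.
move=> FK; have [_ cF] := facetP _ FK.
rewrite -binSn -cF -cards_draws; apply: eq_card => r; rewrite !inE.
apply/andP/andP => [[/andP[_ cr] rF]|[rF cr]]; first by rewrite prednK // in cr.
split=> //; have /ridgeP[-> ->] := ridge_in_facet FK rF (eqP cr).
by rewrite prednK /=.
Qed.

(** This is where simpliciality enters: two facets have at most one common
ridge, so the graph below has no cycle of length 4. *)
Lemma ridge_meet F F' r : F \in facets K -> F' \in facets K -> F != F' ->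
  r \in ridges K d -> r \subset F -> r \subset F' -> r = F :&: F'.
Proof.
move=> /facetP[_ cF] /facetP[_ cF'] FF' /ridgeP[_ cr] rF rF'.
apply/eqP; rewrite eqEcard subsetI rF rF' cr /= leqNgt; apply: contra FF' => cI.
have FI : F :&: F' = F by apply/eqP; rewrite eqEcard subsetIl cF.
by rewrite eqEcard cF cF' leqnn andbT -{1}FI subsetIr.
Qed.

Definition nonfree_in F := [set r in nonfree_ridges K d | r \subset F].
Definition free_in F := [set r in free_ridges K d | r \subset F].

Lemma in_facets_through F r :
  (F \in facets_through K r) = (F \in facets K) && (r \subset F).
Proof. by rewrite in_set. Qed.

Lemma free_ridge r : r \in free_ridges K d -> r \in ridges K d.
Proof. by rewrite inE => /andP[]. Qed.

Lemma nonfree_ridge r : r \in nonfree_ridges K d -> r \in ridges K d.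
Proof. by rewrite inE => /andP[]. Qed.

Lemma card_through_gt0 r : r \in ridges K d -> 0 < #|facets_through K r|.
Proof.
case/ridgeP=> /facet_over[F FK rF] _; apply/card_gt0P; exists F.
by rewrite inE FK.
Qed.

Lemma nonfreeE r : (r \in nonfree_ridges K d) =
  (r \in ridges K d) && (1 < #|facets_through K r|).
Proof.
rewrite inE [r \in free_ridges _ _]inE; case rK: (r \in ridges K d); rewrite ?andbF //=.
by have := card_through_gt0 rK; rewrite andbT; case: #|_| => [|[]].
Qed.

Lemma card_free_nonfree F : F \in facets K -> #|free_in F| + #|nonfree_in F| = d.+1.
Proof.
move=> FK; rewrite -(card_ridges_in FK) -[RHS](cardsID (free_ridges K d)); congr (_ + _).
  apply: eq_card => r; rewrite !inE -andbA [in RHS]andbC.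
  by case: (_ \in K); case: (_ == _); case: (_ \subset _); rewrite /= ?andbF ?andbT.
apply: eq_card => r; rewrite !in_set.
by case: (_ \in K); case: (_ == _); case: (_ \subset _); rewrite /= ?andbF ?andbT.
Qed.

Lemma sum_free_in : \sum_(F in facets K) #|free_in F| = #|free_ridges K d|.
Proof.
under eq_bigr do rewrite card_set_in.
rewrite exchange_big -sum1_card; apply: eq_bigr => r.
by rewrite inE => /andP[_ /eqP <-]; rewrite card_set_in.
Qed.

Lemma sum_nonfree_in : \sum_(F in facets K) #|nonfree_in F| =
  \sum_(r in nonfree_ridges K d) #|facets_through K r|.
Proof.
under eq_bigr do rewrite card_set_in.
by rewrite exchange_big; apply: eq_bigr => r _; rewrite card_set_in.
Qed.

(** The vertices of the graph are facets and nonfree ridges, both as sets; no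
set is both, for reasons of dimension. *)
Definition node_set := facets K :|: nonfree_ridges K d.
Definition node := {s : {set V} | s \in node_set}.

Definition incident s t := [&& s \in facets K, t \in nonfree_ridges K d & t \subset s].
Definition adj : rel {set V} := fun s t => incident s t || incident t s.
Definition node_adj : rel node := fun x y => adj (val x) (val y).

Lemma node_adj_sym : symmetric node_adj.
Proof. by move=> x y; rewrite /node_adj /adj orbC. Qed.

Lemma incident_irr s : incident s s = false.
Proof.
apply/negP => /and3P[/facet_not_ridge/negP sF /nonfree_ridge sR _]; exact: sF.
Qed.

Lemma node_adj_irr : irreflexive node_adj.
Proof. by move=> x; rewrite /node_adj /adj incident_irr. Qed.

Lemma adj_facet F t : F \in facets K -> adj F t = (t \in nonfree_in F).
Proof.
move=> FK; rewrite in_set /adj /incident FK /=.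
case FR: (F \in nonfree_ridges K d); last by rewrite andbF orbF.
by case/negP: (facet_not_ridge FK); apply: nonfree_ridge.
Qed.

Lemma adj_ridge r t : r \in nonfree_ridges K d -> adj r t = (t \in facets_through K r).
Proof.
move=> rR; rewrite in_set /adj /incident rR /=.
case rF: (r \in facets K) => //=.
by case/negP: (facet_not_ridge rF); apply: nonfree_ridge.
Qed.

Lemma node_degE (x : node) : deg node_adj x = #|[set t | adj (val x) t]|.
Proof.
rewrite /deg -(card_imset _ (@val_inj _ _ node)); apply: eq_card => t.
apply/imsetP/idP => [[y] |].
  by rewrite !in_set => xy ->.
rewrite in_set => xt; have tA : t \in node_set.
  by rewrite in_set; case/orP: xt => /and3P[h1 h2 _]; rewrite ?h1 ?h2 ?orbT.
by exists (exist _ t tA); rewrite ?in_set.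
Qed.

Lemma deg_facet (x : node) : val x \in facets K -> deg node_adj x = #|nonfree_in (val x)|.
Proof. by move=> xF; rewrite node_degE; apply: eq_card => t; rewrite in_set adj_facet. Qed.

Lemma deg_ridge (x : node) : val x \in nonfree_ridges K d ->
  deg node_adj x = #|facets_through K (val x)|.
Proof. by move=> xF; rewrite node_degE; apply: eq_card => t; rewrite in_set adj_ridge. Qed.

Lemma disjoint_node_set : [disjoint facets K & nonfree_ridges K d].
Proof.
rewrite disjoint_subset; apply/subsetP => F FK; rewrite inE.
by apply: contra (facet_not_ridge FK); apply: nonfree_ridge.
Qed.

Lemma card_node : #|{: node}| = #|facets K| + #|nonfree_ridges K d|.
Proof.
have := (leq_card_setU (facets K) (nonfree_ridges K d)).2.
by rewrite disjoint_node_set => /eqP <-; rewrite card_sig; apply: eq_card.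
Qed.

(** Nonfree ridges lie in at least two facets, so only facets can be leaves; a
facet is one when all its ridges but one are free. *)
Lemma card_leaves : #|leaves node_adj| = #|pendant_facets K d|.
Proof.
rewrite -(card_imset _ (@val_inj _ _ node)); apply: eq_card => F.
rewrite [in RHS]in_set; apply/imsetP/andP => [[x]|[FK /eqP pF]].
  rewrite in_set => dx ->; have := valP x; rewrite in_set => /orP[xF|xR].
    split=> //; rewrite deg_facet // in dx.
    by have := card_free_nonfree xF; rewrite (eqP dx) addn1 => -[->].
  rewrite deg_ridge // in dx; move: (xR); by rewrite nonfreeE (eqP dx) ltnn andbF.
have FA : F \in node_set by rewrite in_set FK.
exists (exist _ F FA) => //; rewrite in_set deg_facet //=.
by have /eqP := card_free_nonfree FK; rewrite /free_in pF -addn1 eqn_add2l.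
Qed.

Lemma sum_deg : \sum_x deg node_adj x = 2 * \sum_(F in facets K) #|nonfree_in F|.
Proof.
rewrite mul2n -addnn [in X in _ + X]sum_nonfree_in.
rewrite (eq_bigr (fun x : node => #|[set t | adj (val x) t]|)) => [|x _]; last first.
  exact: node_degE.
rewrite -(big_sub (mem node_set) (fun s => #|[set t | adj s t]|)).
rewrite (eq_bigl [predU facets K & nonfree_ridges K d]) => [|s]; last by rewrite !inE.
rewrite bigU ?disjoint_node_set //=; congr (_ + _).
  by apply: eq_bigr => F FK; apply: eq_card => t; rewrite in_set adj_facet.
by apply: eq_bigr => r rK; apply: eq_card => t; rewrite in_set adj_ridge.
Qed.

Lemma card_ridgesE : #|ridges K d| = #|free_ridges K d| + #|nonfree_ridges K d|.
Proof.
rewrite -[LHS](cardsID (free_ridges K d)); congr (_ + _).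
by apply: eq_card => r; rewrite in_set andb_idl //; apply: free_ridge.
Qed.

(** Count the pairs of a facet and a ridge in it: each facet has [d + 1] ridges and
each free ridge has one facet, so removing the free ridges removes as many edges
as vertices. Hence the cyclomatic number of the graph is [theta]. *)
Lemma theta_graph :
  (Posz (\sum_x deg node_adj x) + 2 = 2 * theta K d + Posz (2 * #|{: node}|))%R.
Proof.
have h1 := sum_deg; have h2 := card_node; have h3 := card_ridgesE.
have h4 := sum_free_in.
have h5 : \sum_(F in facets K) #|free_in F| + \sum_(F in facets K) #|nonfree_in F|
    = #|facets K| * d.+1.
  by rewrite -big_split /= -sum_nat_const; apply: eq_bigr => F; apply: card_free_nonfree.
rewrite /theta -facets_faces; nia.
Qed.

Lemma two_facets_nonfree F F' r : F \in facets K -> F' \in facets K ->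
  F != F' -> r \in ridges K d -> r \subset F -> r \subset F' ->
  r \in nonfree_ridges K d.
Proof.
move=> FK FK' FF' rK rF rF'; rewrite nonfreeE rK /=; apply/card_gt1P.
by exists F, F'; split=> //; rewrite in_set ?FK ?FK'.
Qed.

Hypotheses (connK : ridge_connected K d) (two_facets : 1 < #|facets K|).

Lemma node_connected : connected_rel node_adj.
Proof.
have facet_conn (x y : node) : val x \in facets K -> val y \in facets K ->
    connect node_adj x y.
  move=> xK yK; have /connectP[p pp lp] := connK xK yK.
  elim: p x xK pp lp => [|G p IH] x xK /=.
    by move=> _ E; rewrite (val_inj E) connect0.
  case/andP=> /and3P[_ GK /exists_inP[r rK /andP[rx rG]]] pp lp.
  have GA : G \in node_set by rewrite in_set GK.
  apply: connect_trans _ (IH (exist _ G GA) GK pp lp).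
  case: (eqVneq (val x) G) => [E|xG].
    by rewrite (_ : exist _ G GA = x) ?connect0 //; apply: val_inj.
  have rN := two_facets_nonfree xK GK xG rK rx rG.
  have rA : r \in node_set by rewrite in_set rN orbT.
  apply: (@connect_trans _ _ (exist _ r rA)); apply: connect1.
    by rewrite /node_adj /adj /incident xK rN rx.
  by rewrite /node_adj /adj /incident GK rN rG orbT.
have to_facet (x : node) : exists2 y : node, val y \in facets K & connect node_adj x y.
  have := valP x; rewrite in_set => /orP[xK|xN]; first by exists x.
  have /ridgeP[/facet_over[F FK xF] _] := nonfree_ridge xN.
  have FA : F \in node_set by rewrite in_set FK.
  exists (exist _ F FA) => //; apply: connect1.
  by rewrite /node_adj /adj /incident FK xN xF orbT.
move=> x y; have [x' x'K xx'] := to_facet x; have [y' y'K yy'] := to_facet y.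
apply: connect_trans xx' (connect_trans (facet_conn _ _ x'K y'K) _).
by rewrite (sym_connect_sym node_adj_sym).
Qed.

Lemma card_node_gt1 : 1 < #|{: node}|.
Proof. by rewrite card_node; apply: leq_trans two_facets (leq_addr _ _). Qed.

End IncidenceGraph.

Arguments node_adj {V} K d _ _.

(** * Two-regular complexes are cycles *)

Section Other.
Variable T : finType.
Implicit Types (S : {set T}) (x y : T).

(** Meant for a two-element set [S] that contains [x]. *)
Definition other S x := odflt x [pick y in S | y != x].

Lemma otherP S x : #|S| = 2 -> x \in S ->
  S = [set x; other S x] /\ other S x != x.
Proof.
move=> S2 xS; rewrite /other; case: pickP => [y /andP[yS yx]|none] /=.
  split=> //; apply/esym/eqP; rewrite eqEcard S2 cards2 eq_sym yx andbT.
  by apply/subsetP => z; rewrite !inE => /orP[] /eqP ->.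
have : 0 < #|S :\ x| by have := cardsD1 x S; rewrite S2 xS add1n => -[<-].
by case/card_gt0P=> y; rewrite !inE andbC none.
Qed.

Lemma otherK S x : #|S| = 2 -> x \in S -> other S (other S x) = x.
Proof.
move=> S2 xS; have [ES nx] := otherP S2 xS.
have oS : other S x \in S by rewrite {2}ES !inE eqxx orbT.
have [ES' nx'] := otherP S2 oS; apply/eqP.
by move: xS; rewrite {1}ES' !inE [x == _]eq_sym (negPf nx) /= eq_sym.
Qed.
End Other.

Section Dihedral.
Variables (T : finType) (alpha beta : T -> T) (D : pred T).
Hypotheses (alphaK : involutive alpha) (betaK : involutive beta).
Hypothesis alphaD : forall t, D t -> D (alpha t).
Hypothesis betaD : forall t, D t -> D (beta t).
Hypothesis alpha_neq : forall t, D t -> alpha t != t.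
Hypothesis beta_neq : forall t, D t -> beta t != t.

Definition rotation t := beta (alpha t).

Lemma rotation_inj : injective rotation.
Proof. exact: inj_comp (inv_inj betaK) (inv_inj alphaK). Qed.

Lemma rotationD t : D t -> D (rotation t).
Proof. by move=> /alphaD/betaD. Qed.

Lemma iter_rotationD k t : D t -> D (iter k rotation t).
Proof. by move=> Dt; elim: k => //= k /rotationD. Qed.

(** If [beta t] were the [k]-th rotate of [t], then [beta] would send the next
rotate of [t] to its own [(k - 2)]-th rotate; so [k] reduces to 0 or 1, where
[beta] or [alpha] would have a fixed point. *)
Lemma beta_not_orbit t : D t -> ~~ fconnect rotation t (beta t).
Proof.
move=> Dt; apply/negP => /iter_findex; move: (findex _ _ _) => k.
have [n] := ubnP k; elim: n k t Dt => // n IH [|[|k]] t Dt.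
- by move=> _ /= E; have := beta_neq Dt; rewrite -E eqxx.
- by move=> _ /= /(inv_inj betaK) E; have := alpha_neq Dt; rewrite E eqxx.
rewrite ltnS iterSr iterS => kn /(inv_inj betaK) E.
apply: (IH k (rotation t)); [exact: rotationD | lia |].
by rewrite -[LHS]alphaK E /rotation betaK.
Qed.

Lemma alpha_not_orbit t : D t -> ~~ fconnect rotation t (alpha t).
Proof.
move=> Dt; apply: contra (beta_not_orbit (alphaD Dt)).
rewrite (fconnect_sym rotation_inj) => ut; apply: connect_trans ut (connect1 _).
exact: eqxx.
Qed.
End Dihedral.

Section Cycle.
Variables (V : finType) (K : {set {set V}}) (d : nat).
Implicit Types (F G r s : {set V}) (t : {set V} * {set V}).
Hypotheses (d_gt0 : 0 < d) (cplxK : is_complex K) (pureK : pure K d).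
Hypotheses (connK : ridge_connected K d) (two_facets : 1 < #|facets K|).

Section TwoRegular.
Hypothesis facet2 : forall F, F \in facets K -> #|nonfree_in K d F| = 2.
Hypothesis ridge2 : forall r, r \in nonfree_ridges K d -> #|facets_through K r| = 2.

(** Each facet has two nonfree ridges, each nonfree ridge lies in two facets:
from a flag (facet, ridge) one may cross the ridge to the other facet, or turn to
the other ridge of the facet. Both maps are the identity off the flags, which
makes them involutions of the whole type. *)
Definition flag t := incident K d t.1 t.2.
Definition cross t := if flag t then (other (facets_through K t.2) t.1, t.2) else t.
Definition turn t := if flag t then (t.1, other (nonfree_in K d t.1) t.2) else t.

Lemma flag_facet t : flag t -> [/\ t.1 \in facets K, #|nonfree_in K d t.1| = 2
  & t.2 \in nonfree_in K d t.1].
Proof. by case/and3P=> h1 h2 h3; split=> //; [exact: facet2 | rewrite in_set h2]. Qed.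

Lemma flag_ridge t : flag t -> [/\ t.2 \in nonfree_ridges K d, #|facets_through K t.2| = 2
  & t.1 \in facets_through K t.2].
Proof. by case/and3P=> h1 h2 h3; split=> //; [exact: ridge2 | rewrite in_set h1]. Qed.

Lemma crossD t : flag t -> flag (cross t).
Proof.
move=> ft; rewrite /cross ft; have [h1 h2 h3] := flag_ridge ft.
have [E _] := otherP h2 h3.
have : other (facets_through K t.2) t.1 \in facets_through K t.2.
  by rewrite {2}E !inE eqxx orbT.
by rewrite in_set /flag /incident /= h1 => /andP[-> ->].
Qed.

Lemma turnD t : flag t -> flag (turn t).
Proof.
move=> ft; rewrite /turn ft; have [h1 h2 h3] := flag_facet ft.
have [E _] := otherP h2 h3.
have : other (nonfree_in K d t.1) t.2 \in nonfree_in K d t.1.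
  by rewrite {2}E !inE eqxx orbT.
by rewrite in_set /flag /incident /= h1 => /andP[-> ->].
Qed.

Lemma crossK : involutive cross.
Proof.
move=> t; case ft: (flag t); last by rewrite /cross ft ft.
have [_ h2 h3] := flag_ridge ft.
have := crossD ft; rewrite {1 3}/cross ft /= => fc.
by rewrite /cross fc /= otherK //; case: (t).
Qed.

Lemma turnK : involutive turn.
Proof.
move=> t; case ft: (flag t); last by rewrite /turn ft ft.
have [_ h2 h3] := flag_facet ft.
have := turnD ft; rewrite {1 3}/turn ft /= => fc.
by rewrite /turn fc /= otherK //; case: (t).
Qed.

Lemma cross_neq1 t : flag t -> (cross t).1 != t.1.
Proof.
move=> ft; have [_ h2 h3] := flag_ridge ft.
by rewrite /cross ft; case: (otherP h2 h3).
Qed.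

Lemma turn_neq2 t : flag t -> (turn t).2 != t.2.
Proof.
move=> ft; have [_ h2 h3] := flag_facet ft.
by rewrite /turn ft; case: (otherP h2 h3).
Qed.

Lemma cross_neq t : flag t -> cross t != t.
Proof. by move/cross_neq1; apply: contraNneq => ->. Qed.

Lemma turn_neq t : flag t -> turn t != t.
Proof. by move/turn_neq2; apply: contraNneq => ->. Qed.

Lemma cross_ridge t : flag t -> facets_through K t.2 = [set t.1; (cross t).1].
Proof.
move=> ft; have [_ h2 h3] := flag_ridge ft.
by rewrite /cross ft /=; case: (otherP h2 h3).
Qed.

Lemma turn_facet t : flag t -> nonfree_in K d t.1 = [set t.2; (turn t).2].
Proof.
move=> ft; have [_ h2 h3] := flag_facet ft.
by rewrite /turn ft /=; case: (otherP h2 h3).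
Qed.

Lemma cross2 t : (cross t).2 = t.2. Proof. by rewrite /cross; case: ifP. Qed.
Lemma turn1 t : (turn t).1 = t.1. Proof. by rewrite /turn; case: ifP. Qed.

Local Notation step := (rotation cross turn).

Lemma same_facet t u : flag t -> flag u -> t.1 = u.1 -> u = t \/ u = turn t.
Proof.
move=> ft fu E; have [_ _ ] := flag_facet fu; rewrite -E turn_facet // !inE.
case/orP=> /eqP E2; [left|right]; apply/eqP; rewrite [_ == _]xpair_eqE.
  by rewrite E E2 !eqxx.
by rewrite turn1 E E2 !eqxx.
Qed.

Lemma same_ridge t u : flag t -> flag u -> t.2 = u.2 -> u = t \/ u = cross t.
Proof.
move=> ft fu E; have [_ _ ] := flag_ridge fu; rewrite -E cross_ridge // !inE.
case/orP=> /eqP E2; [left|right]; apply/eqP; rewrite [_ == _]xpair_eqE.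
  by rewrite E E2 !eqxx.
by rewrite cross2 E E2 !eqxx.
Qed.

(** Crossing and turning in alternation goes round a cycle. The orbit of a flag
meets each facet in one flag only, as it never contains the turned flag, and each
nonfree ridge in one flag only, as it never contains the crossed flag; by
connectedness it meets them all. *)
Lemma two_regular_cycle : simplicial_cycle K d.
Proof.
have step_inj : injective step := rotation_inj crossK turnK.
have stepD := rotationD crossD turnD.
have [F0 F0K] : exists F, F \in facets K by apply/card_gt0P; apply: ltnW.
have [r0 r0F] : exists r, r \in nonfree_in K d F0 by apply/card_gt0P; rewrite facet2.
pose t0 := (F0, r0).
have ft0 : flag t0 by rewrite /flag /incident /= F0K; move: r0F; rewrite in_set.
pose m := order step t0.
pose tt (k : nat) := iter k step t0.
have ftt k : flag (tt k) by apply: iter_rotationD; [exact: crossD | exact: turnD |].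
have ott i j : fconnect step (tt i) (tt j).
  apply: (@connect_trans _ _ t0); last exact: fconnect_iter.
  by rewrite (fconnect_sym step_inj) fconnect_iter.
have orb t : fconnect step t0 t -> exists k : 'I_m, tt k = t.
  by move=> tc; exists (Ordinal (findex_max tc)); apply: iter_findex.
have ttS (k : 'I_m) : tt (ordS k) = step (tt k).
  rewrite -[RHS]/(tt k.+1) -[LHS]/(tt (k.+1 %% m)).
  have := ltn_ord k; rewrite leq_eqVlt => /orP[/eqP E|lt].
    by rewrite E modnn /tt /m iter_order.
  by rewrite modn_small.
have tt_inj (i j : 'I_m) : tt i = tt j -> i = j.
  move=> E; apply: val_inj; rewrite /= -(findex_iter (ltn_ord i)) -(findex_iter (ltn_ord j)).
  by congr findex.
have noturn := beta_not_orbit crossK turnK crossD turnD cross_neq turn_neq.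
have nocross := alpha_not_orbit crossK turnK crossD turnD cross_neq turn_neq.
have F_inj (i j : 'I_m) : (tt i).1 = (tt j).1 -> i = j.
  move=> /(same_facet (ftt i) (ftt j))[/esym/tt_inj // | E].
  by have := noturn _ (ftt i); rewrite -E ott.
have R_inj (i j : 'I_m) : (tt i).2 = (tt j).2 -> i = j.
  move=> /(same_ridge (ftt i) (ftt j))[/esym/tt_inj // | E].
  by have := nocross _ (ftt i); rewrite -E ott.
have thr (k : 'I_m) : facets_through K (tt k).2 = [set (tt k).1; (tt (ordS k)).1].
  by rewrite ttS /rotation turn1 cross_ridge.
have prev t : fconnect step t0 t -> flag t -> fconnect step t0 (cross (turn t)).
  move=> tc ft; apply: connect_trans tc _; rewrite (fconnect_sym step_inj).
  by apply: connect1; rewrite /rotation /= crossK turnK.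
have Fstep F G t : share_ridge K d F G -> fconnect step t0 t -> flag t -> t.1 = F ->
    exists2 u, fconnect step t0 u /\ flag u & u.1 = G.
  case/and3P=> FK GK /exists_inP[r rK /andP[rF rG]] tc ft tF.
  case: (eqVneq F G) => [FG|FG]; first by exists t; rewrite // tF.
  have rN := two_facets_nonfree d_gt0 FK GK FG rK rF rG.
  have fu : flag (F, r) by rewrite /flag /incident FK rN rF.
  have Gc : (cross (F, r)).1 = G.
    have : G \in facets_through K (F, r).2 by rewrite in_set GK.
    by rewrite cross_ridge // !inE eq_sym (negPf FG) => /eqP.
  have [E|E] := same_facet ft fu tF.
    exists (step t); last by rewrite /rotation turn1 -E.
    by split; [apply: connect_trans tc (connect1 _); exact: eqxx | exact: stepD].
  exists (cross (turn t)); last by rewrite -E.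
  by split; [exact: prev | rewrite -E; apply: crossD].
have Fsurj G : G \in facets K -> exists2 t, fconnect step t0 t /\ flag t & t.1 = G.
  move=> GK; have /connectP[p pp ->] := connK F0K GK.
  suff walk p' F : path (share_ridge K d) F p' ->
      (exists2 t, fconnect step t0 t /\ flag t & t.1 = F) ->
      exists2 t, fconnect step t0 t /\ flag t & t.1 = last F p'.
    by apply: walk => //; exists t0; rewrite ?connect0.
  elim: p' F => [|H p' IH] F //= /andP[FH pp'] [t [tc ft] tF].
  by apply: IH pp' _; apply: Fstep FH tc ft tF.
exists m, (fun k => (tt k).1), (fun k => (tt k).2); split.
- have m1 : 0 < m by apply: order_gt0.
  have n1 t : flag t -> (step t).1 != t.1.
    by move=> ft; rewrite /rotation turn1 cross_neq1.
  have : iter m step t0 = t0 by apply: iter_order.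
  (* With two facets, both ridges of the cycle would be their intersection. *)
  case: (m) m1 => [|[|[|k]]] // _ /= E; first by have := n1 _ ft0; rewrite E eqxx.
  have fu : flag (step t0) := stepD _ ft0; set u := step t0 in E fu.
  have /eqP[] : u.2 != t0.2.
    by rewrite /u /rotation -(cross2 t0); apply/turn_neq2/crossD.
  have [/nonfree_ridge rK0 _ _] := flag_ridge ft0.
  have [/nonfree_ridge rKu _ _] := flag_ridge fu.
  have /and3P[F0' _ s0] := ft0; have /and3P[Fu _ su] := fu.
  have /and3P[_ _ s0u] := crossD ft0; have /and3P[_ _ su0] := crossD fu.
  rewrite -[(cross t0).1]turn1 cross2 in s0u.
  rewrite -[(cross u).1]turn1 cross2 -/(step u) E in su0.
  have n := n1 _ ft0.
  rewrite (ridge_meet d_gt0 pureK Fu F0' n rKu su su0).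
  by rewrite -(ridge_meet d_gt0 pureK Fu F0' n rK0 s0u s0).
- split; first exact: F_inj.
  apply/setP => G; apply/imsetP/idP => [[k _ ->]|]; first by case: (flag_facet (ftt k)).
  by case/Fsurj=> t [tc _] <-; have [k <-] := orb _ tc; exists k.
- split; first exact: R_inj.
  apply/setP => r; apply/imsetP/idP => [[k _ ->]|rN]; first by case: (flag_ridge (ftt k)).
  have [F] : exists F, F \in facets_through K r by apply/card_gt0P; rewrite ridge2.
  rewrite in_set => /andP[FK rF]; have [t [tc ft] tF] := Fsurj _ FK.
  have fu : flag (F, r) by rewrite /flag /incident FK rN rF.
  have [E|E] := same_facet ft fu tF.
    by have [k Ek] := orb _ tc; exists k; rewrite // Ek -E.
  by have [k Ek] := orb _ (prev _ tc ft); exists k; rewrite // Ek cross2 -E.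
- move=> k; have [/nonfree_ridge rK _ _] := flag_ridge (ftt k).
  have := subxx (facets_through K (tt k).2); rewrite {1}thr subUset !sub1set !in_facets_through.
  case/andP=> /andP[h1 h2] /andP[h3 h4]; apply: (ridge_meet d_gt0 pureK h1 h3 _ rK h2 h4).
  by rewrite ttS /rotation turn1 eq_sym cross_neq1.
- exact: thr.
Qed.
End TwoRegular.
End Cycle.

Lemma ordS_neq m (k : 'I_m) : 1 < m -> ordS k != k.
Proof.
move=> m1; apply/eqP => /(congr1 val) /=; have := ltn_ord k.
rewrite leq_eqVlt => /orP[/eqP E|lt]; last by rewrite modn_small //; lia.
by rewrite E modnn; lia.
Qed.

Section CycleCounts.
Variables (V : finType) (K : {set {set V}}) (d : nat).
Implicit Types (F G r s : {set V}).
Hypotheses (d_gt0 : 0 < d) (cplxK : is_complex K) (pureK : pure K d).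

Section GivenCycle.
Variables (m : nat) (F R : 'I_m -> {set V}).
Hypotheses (m3 : 2 < m) (F_inj : injective F) (R_inj : injective R).
Hypothesis R_im : [set R k | k : 'I_m] = nonfree_ridges K d.
Hypothesis thr : forall k, facets_through K (R k) = [set F k; F (ordS k)].

Lemma cycle_nonfree_in k : nonfree_in K d (F k) = [set R k; R (ord_pred k)].
Proof.
have FK j : F j \in facets K.
  have : F j \in facets_through K (R j) by rewrite thr !inE eqxx.
  by rewrite in_facets_through => /andP[].
have Rsub j l : (R j \subset F l) = (l == j) || (l == ordS j).
  have := in_facets_through K (F l) (R j); rewrite FK /= => <-.
  by rewrite thr !inE !(inj_eq F_inj).
apply/setP => r; rewrite in_set -R_im in_set2; apply/andP/orP.
  case=> /imsetP[j _ ->]; rewrite Rsub => /orP[]/eqP ->; [by left | right].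
  by rewrite ordSK.
case=> /eqP ->; split; try exact: imset_f.
  by rewrite Rsub eqxx.
by rewrite Rsub ord_predK eqxx orbT.
Qed.

Lemma cycle_card_nonfree_in k : #|nonfree_in K d (F k)| = 2.
Proof.
by rewrite cycle_nonfree_in cards2 (inj_eq R_inj) -{1}[k]ord_predK (ordS_neq _ (ltnW m3)).
Qed.
End GivenCycle.

Lemma cycle_theta_pendant : simplicial_cycle K d ->
  (theta K d, #|pendant_facets K d|) = (Posz 1, 0).
Proof.
case=> m [F [R [m3 [Fi FE] [Ri RE] _ thr]]].
have nf2 G : G \in facets K -> #|nonfree_in K d G| = 2.
  by rewrite -FE => /imsetP[k _ ->]; apply: cycle_card_nonfree_in RE thr k.
have cF : #|facets K| = m by rewrite -FE card_imset // card_ord.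
have cR : #|nonfree_ridges K d| = m by rewrite -RE card_imset // card_ord.
have /eqP p0 : #|pendant_facets K d| == 0.
  rewrite cards_eq0; apply/eqP/setP => G; rewrite in_set0 in_set.
  apply/negP => /andP[GK /eqP E]; have := card_free_nonfree d_gt0 cplxK pureK GK.
  rewrite nf2 // /free_in E addn2 => -[]; lia.
have := theta_graph d_gt0 cplxK pureK.
rewrite sum_deg // card_node // (eq_bigr (fun _ => 2)) //.
rewrite sum_nat_const cF cR p0 => h; congr pair; lia.
Qed.

Hypotheses (connK : ridge_connected K d) (two_facets : 1 < #|facets K|).

(** A connected graph with cyclomatic number 1 and no leaf has minimal degree 2
and average degree 2, so that all its degrees are 2. *)
Lemma cycle_iff : simplicial_cycle K d <->
  (theta K d, #|pendant_facets K d|) = (Posz 1, 0).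
Proof.
split; first exact: cycle_theta_pendant.
case=> th p0.
have conn := node_connected d_gt0 connK.
have n2 := card_node_gt1 d_gt0 pureK two_facets.
have nl : leaves (node_adj K d) = set0.
  by apply/eqP; rewrite -cards_eq0 card_leaves // p0.
have sd : \sum_x deg (node_adj K d) x = 2 * #|{: node K d}|.
  by have := theta_graph d_gt0 cplxK pureK; rewrite th; lia.
have d2 := deg_eq2 conn n2 nl sd.
have facet_node F : F \in facets K -> F \in node_set K d by move=> FK; rewrite in_set FK.
have ridge_node r : r \in nonfree_ridges K d -> r \in node_set K d.
  by move=> rK; rewrite in_set rK orbT.
apply: two_regular_cycle => //.
  by move=> F FK; rewrite -(d2 (exist _ F (facet_node F FK))) deg_facet.
by move=> r rK; rewrite -(d2 (exist _ r (ridge_node r rK))) deg_ridge.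
Qed.

End CycleCounts.

Import Order.TTheory GRing.Theory Num.Theory.
Local Open Scope ring_scope.

(** * Eigenvectors and zero forcing *)

Section MatrixLemmas.
Variable F : fieldType.

(** The map [C] is injective on the row space of [E]. *)
Lemma rank_le_separating m n s (E : 'M[F]_(m, n)) (C : 'M[F]_(n, s)) :
  (forall v : 'rV_n, (v <= E)%MS -> v *m C = 0 -> v = 0) -> (\rank E <= s)%N.
Proof.
move=> sep; rewrite -(mxrank_mul_ker E C).
have /eqP -> : (E :&: kermx C)%MS == 0.
  by apply/rowV0P => v; rewrite sub_capmx => /andP[vE /sub_kermxP]; apply: sep.
by rewrite mxrank0 addn0 rank_leq_col.
Qed.

(** Away from 0, [B *m B^T] has the eigenvalues of [B^T *m B]: [X] is sent to
[X *m B^T]. *)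
Lemma eigenspace_gram_ge k m n (B : 'M[F]_(m, n)) (X : 'M[F]_(k, n)) lambda :
  lambda != 0 -> row_free X -> X *m (B^T *m B) = lambda *: X ->
  (k <= \rank (eigenspace (B *m B^T) lambda))%N.
Proof.
move=> l0 Xfree eigX.
have : (X *m B^T <= eigenspace (B *m B^T) lambda)%MS.
  apply/eigenspaceP; rewrite scalemxAl -eigX.
  by rewrite !mulmxA.
move/mxrankS; apply: leq_trans.
rewrite -[leqLHS](eqP Xfree) -(mxrank_scale_nz _ l0) -eigX mulmxA.
exact: mxrankM_maxl.
Qed.
End MatrixLemmas.

Section BoundaryCoefficients.
Variables (R : realFieldType) (V : finType) (K : {set {set V}}).
Variable (o : {set V} -> seq V).
Hypothesis orient_o : is_orientation K o.
Implicit Types (s t : {set V}).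

Lemma face_entries s t (j : 'I_(size (o s))) : s \in K ->
  [set x in take j (o s) ++ drop j.+1 (o s)] = s :\ tnth (in_tuple (o s)) j.
Proof.
move=> sK; have os := orient_o sK.
have us : uniq (o s) by rewrite (perm_uniq os) enum_uniq.
set v := tnth _ _.
have iv : index v (o s) = j by rewrite /v (tnth_nth v) index_uniq.
apply/setP => x; rewrite -iv -remE !inE mem_rem_uniq // !inE.
by rewrite (perm_mem os) mem_enum.
Qed.

Lemma boundary_coef_notin s t : s \in K -> ~~ (t \subset s) ->
  boundary_coef R o t s = 0.
Proof.
move=> sK ts; rewrite /boundary_coef big1 // => j _.
rewrite /oriented_coef face_entries //; case: eqP => [E|]; last by rewrite mulr0.
by case/negP: ts; rewrite -E subD1set.
Qed.

(** Only the term deleting the vertex of [s] that [t] misses contributes. *)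
Lemma boundary_coef_sq s t : s \in K -> t \subset s -> #|s| = #|t|.+1 ->
  boundary_coef R o t s * boundary_coef R o t s = 1.
Proof.
move=> sK ts cs; have os := orient_o sK.
have us : uniq (o s) by rewrite (perm_uniq os) enum_uniq.
have /cards1P[v Ev] : #|s :\: t| == 1%N.
  by rewrite cardsD (setIidPr ts) cs subSnn.
have Et : t = s :\ v.
  by rewrite -Ev setDDr setDv set0U (setIidPr ts).
have vs : v \in s by have := set11 v; rewrite -Ev inE => /andP[].
have vos : v \in o s by rewrite (perm_mem os) mem_enum.
have jP : (index v (o s) < size (o s))%N by rewrite index_mem.
have [j vj] : exists j, tnth (in_tuple (o s)) j = v.
  by exists (Ordinal jP); rewrite (tnth_nth v) /= nth_index.
rewrite /boundary_coef (bigD1 j) //= [X in _ + X]big1 => [|i ij].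
  rewrite addr0 /oriented_coef face_entries // vj Et eqxx.
  by rewrite mulrACA -!expr2 !sqrr_sign mulr1.
rewrite /oriented_coef face_entries // Et; case: eqP => [E|]; last by rewrite mulr0.
have : tnth (in_tuple (o s)) i \notin s :\ v by rewrite -E !inE eqxx.
rewrite !inE negb_and negbK => /orP[/eqP E2|]; last first.
  by rewrite -mem_enum -(perm_mem os) mem_tnth.
by case/eqP: ij; apply/(tuple_uniqP (in_tuple (o s))); rewrite // vj.
Qed.
End BoundaryCoefficients.

Section Bound.
Variables (R : realFieldType) (V : finType) (K : {set {set V}}) (d : nat).
Variable (o : {set V} -> seq V).
Hypotheses (d_gt0 : (0 < d)%N) (cplxK : is_complex K) (pureK : pure K d).
Hypothesis orient_o : is_orientation K o.
Implicit Types (F G r s t : {set V}).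

Local Notation bd := (boundary_coef R o).
Local Notation B := (boundary R o K d.-1).

Lemma facet_coef0 r F : F \in facets K -> ~~ (r \subset F) -> bd r F = 0.
Proof. by case/(facetP pureK)=> FK _; apply: (boundary_coef_notin _ orient_o). Qed.

Lemma facet_coef_sq r F : F \in facets K -> r \in ridges K d -> r \subset F ->
  bd r F * bd r F = 1.
Proof.
case/(facetP pureK)=> FK cF /(ridgeP K d_gt0)[_ cr] rF.
by apply: (boundary_coef_sq _ orient_o); rewrite // cF cr.
Qed.

Lemma facet_coef_neq0 r F : F \in facets K -> r \in ridges K d -> r \subset F ->
  bd r F != 0.
Proof.
move=> FK rK rF; apply/eqP => b0; have := facet_coef_sq FK rK rF.
by rewrite b0 mul0r => /esym/eqP; rewrite oner_eq0.
Qed.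

Lemma sum_facet_index (g : {set V} -> R) :
  \sum_(j < #|faces K d.-1.+1|) g (enum_val j) = \sum_(F in facets K) g F.
Proof. by rewrite -big_enum_val prednK // (facets_faces pureK). Qed.

Lemma sum_ridge_index (g : {set V} -> R) :
  \sum_(j < #|faces K d.-1|) g (enum_val j) = \sum_(r in ridges K d) g r.
Proof. by rewrite -big_enum_val. Qed.

(** Ridge vectors are read as functions on sets, which frees what follows from
the enumeration of the ridges. *)
Definition ridge_value (y : 'rV[R]_#|faces K d.-1|) r :=
  \sum_a y 0 a * (enum_val a == r)%:R.

Lemma ridge_value_enum y a : ridge_value y (enum_val a) = y 0 a.
Proof.
rewrite /ridge_value (bigD1 a) //= eqxx mulr1 big1 ?addr0 // => c ca.
by rewrite (inj_eq enum_val_inj) (negPf ca) mulr0.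
Qed.

Definition coboundary (Y : {set V} -> R) F := \sum_(r in ridges K d) Y r * bd r F.

Lemma coboundaryE y F :
  coboundary (ridge_value y) F = \sum_a y 0 a * bd (enum_val a) F.
Proof.
rewrite /coboundary -(sum_ridge_index (fun r => ridge_value y r * bd r F)).
by apply: eq_bigr => a _; rewrite ridge_value_enum.
Qed.

(** The eigenvector equation split in two: through the facet values
[coboundary Y], the adjacency is that of facets and ridges. *)
Definition eigenridge lambda (Y : {set V} -> R) := forall r, r \in ridges K d ->
  lambda * Y r = \sum_(F in facets K) coboundary Y F * bd r F.

Lemma eigenspace_eigenridge lambda y :
  (y <= eigenspace (up_laplacian R o K d.-1) lambda)%MS ->
  eigenridge lambda (ridge_value y).
Proof.
move=> /eigenspaceP/rowP eig r rK.
have rK' : r \in faces K d.-1 by [].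
rewrite -(enum_rankK_in rK' rK'); set a := enum_rank_in _ _.
have := eig a; rewrite mxE => eiga; rewrite ridge_value_enum.
rewrite mxE in eiga; rewrite -eiga.
rewrite -(sum_facet_index (fun F => coboundary _ F * bd _ F)).
rewrite /up_laplacian.
have -> : \sum_j y 0 j * (B *m B^T) j a = (y *m (B *m B^T)) 0 a by rewrite mxE.
rewrite mulmxA mxE; apply: eq_bigr => j _; rewrite coboundaryE !mxE; congr (_ * _).
by apply: eq_bigr => c _; rewrite mxE.
Qed.

Section Eigenridge.
Variables (lambda : R) (Y : {set V} -> R).
Hypotheses (lambda_gt0 : 0 < lambda) (eigY : eigenridge lambda Y).

Definition node_value (x : node K d) :=
  if val x \in facets K then coboundary Y (val x) else Y (val x).

(** A free ridge is slaved to its facet. This lets the free ridges be dropped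
from the graph. *)
Lemma free_ridge_value r F : r \in free_ridges K d -> F \in facets K -> r \subset F ->
  lambda * Y r = coboundary Y F * bd r F.
Proof.
move=> rfree FK rF; rewrite eigY ?free_ridge // (bigD1 F) //= big1 ?addr0 // => G.
case/andP=> GK GF; rewrite facet_coef0 ?mulr0 //; apply/negP => rG.
move: rfree; rewrite inE => /andP[_ /cards1P[H EH]].
have : F \in facets_through K r by rewrite in_facets_through FK.
have : G \in facets_through K r by rewrite in_facets_through GK.
by rewrite EH !inE => /eqP E1 /eqP E2; rewrite E1 E2 eqxx in GF.
Qed.

(** At a facet [F] where the value vanishes, the free ridges vanish too, and the
equation of [F] involves only its nonfree ridges; at a nonfree ridge, only the
facets through it. All coefficients are nonzero. *)
Lemma zeros_forcing_closed :
  forcing_closed (node_adj K d) [set x | node_value x == 0].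
Proof.
move=> c x; rewrite !inE => c0 cx others; move: c0; rewrite /node_value.
have oth t : t != val x -> adj K d (val c) t ->
    (t \in facets K -> coboundary Y t = 0) /\ (t \notin facets K -> Y t = 0).
  move=> tx ct; have tA : t \in node_set K d.
    by rewrite in_setU; case/orP: ct => /and3P[h1 h2 _]; rewrite ?h1 ?h2 ?orbT.
  have := others (exist _ t tA) ct; rewrite -(inj_eq val_inj) /= => /(_ tx).
  rewrite inE /node_value /=; case: ifP => _ /eqP h; by split.
have notF r : r \in nonfree_ridges K d -> (r \in facets K) = false.
  by move=> rN; apply/negP => /(facet_not_ridge d_gt0 pureK); rewrite nonfree_ridge.
case/orP: cx => /and3P[cK xK sub].
  rewrite cK (notF _ xK) => /eqP c0.
  have := c0; rewrite /coboundary (bigD1 (val x)) ?nonfree_ridge //=.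
  rewrite big1 => [|r /andP[rK rx]].
    move/eqP; rewrite addr0 mulf_eq0 (negPf (facet_coef_neq0 cK (nonfree_ridge xK) sub)).
    by rewrite orbF.
  case: (boolP (r \subset val c)) => [rc|rc]; last by rewrite facet_coef0 ?mulr0.
  case: (boolP (r \in nonfree_ridges K d)) => [rN|].
    have cr : adj K d (val c) r by rewrite /adj /incident cK rN rc.
    by have [_ ->] := oth r rx cr; rewrite ?mul0r ?notF.
  rewrite in_setD rK andbT negbK => rF.
  have /eqP := free_ridge_value rF cK rc.
  by rewrite c0 mul0r mulf_eq0 (gt_eqF lambda_gt0) => /eqP ->; rewrite mul0r.
rewrite cK (notF _ xK) => /eqP Y0.
have := eigY (nonfree_ridge xK); rewrite Y0 mulr0 (bigD1 (val x)) //=.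
rewrite big1 => [/esym/eqP|F /andP[FK Fx]].
  by rewrite addr0 mulf_eq0 (negPf (facet_coef_neq0 cK (nonfree_ridge xK) sub)) orbF.
case: (boolP (val c \subset F)) => [rF|rF]; last by rewrite facet_coef0 ?mulr0.
have cF : adj K d (val c) F by rewrite /adj /incident FK xK rF orbT.
by have [-> // _] := oth F Fx cF; rewrite mul0r.
Qed.

(** Once the values at all the facets are zero, positivity of the eigenvalue gives
the values at the ridges. *)
Lemma eigenridge_eq0 (S : {set node K d}) : zero_forcing (node_adj K d) S ->
  (forall x, x \in S -> node_value x = 0) -> forall r, r \in ridges K d -> Y r = 0.
Proof.
move=> forceS S0 r rK.
have Z0 x : node_value x = 0.
  apply/eqP; suff: x \in [set x | node_value x == 0] by rewrite inE.
  apply: forceS; first exact: zeros_forcing_closed.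
  by apply/subsetP => z zS; rewrite inE S0.
have := eigY rK; rewrite big1 => [/eqP|F FK].
  by rewrite mulf_eq0 (gt_eqF lambda_gt0) => /eqP.
have FA : F \in node_set K d by rewrite in_setU FK.
by have := Z0 (exist _ F FA); rewrite /node_value /= FK => ->; rewrite mul0r.
Qed.
End Eigenridge.

Lemma multiplicity_le_forcing (lambda : R) (S : {set node K d}) : 0 < lambda ->
  zero_forcing (node_adj K d) S -> (multiplicity o K d.-1 lambda <= #|S|)%N.
Proof.
move=> l0 forceS.
(* The columns of C read off the values at the vertices of S. *)
pose C : 'M[R]_(#|faces K d.-1|, #|S|) := \matrix_(a, j)
  let s := val (enum_val j) in
  if s \in facets K then bd (enum_val a) s else (enum_val a == s)%:R.
apply: (rank_le_separating (C := C)) => y yE yC.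
have eigY := eigenspace_eigenridge yE.
have Y0 := eigenridge_eq0 l0 eigY forceS.
apply/rowP => a; rewrite mxE -ridge_value_enum Y0 ?enum_valP // => x xS.
have /rowP/(_ (enum_rank_in xS x)) := yC.
rewrite mxE [RHS]mxE => <-; rewrite /node_value coboundaryE /ridge_value.
case: ifP => xF; apply: eq_bigr => b _; by rewrite mxE /= enum_rankK_in // ?xF.
Qed.

Hypotheses (connK : ridge_connected K d) (two_facets : (1 < #|facets K|)%N).

Lemma multiplicity_le (lambda : R) : 0 < lambda ->
  (multiplicity o K d.-1 lambda)%:Z <= 2 * theta K d + #|pendant_facets K d|%:Z.
Proof.
move=> l0.
have [S fS cS] := zero_forcing_leq (@node_adj_sym _ K d) (node_connected d_gt0 connK)
  (card_node_gt1 d_gt0 pureK two_facets).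
have arith (m a D n p : nat) (th : int) : (a + 2 * n <= D + 2 + p)%N ->
  D%:Z + 2 = 2 * th + (2 * n)%N%:Z -> (m <= a)%N -> m%:Z <= 2 * th + p%:Z by lia.
rewrite -(card_leaves d_gt0 cplxK pureK).
exact: arith cS (theta_graph d_gt0 cplxK pureK) (multiplicity_le_forcing l0 fS).
Qed.

Lemma multiplicity_lt (lambda : R) : 0 < lambda ->
  (theta K d, #|pendant_facets K d|) <> (1, 0%N) ->
  (multiplicity o K d.-1 lambda)%:Z <= 2 * theta K d + #|pendant_facets K d|%:Z - 1.
Proof.
move=> l0 neq; have thE := theta_graph d_gt0 cplxK pureK.
have [|S fS cS] := zero_forcing_lt (@node_adj_sym _ K d) (node_adj_irr d_gt0 pureK)
  (node_connected d_gt0 connK) (card_node_gt1 d_gt0 pureK two_facets).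
  case: (eqVneq (leaves (node_adj K d)) set0) => [nl|]; last by left.
  right; apply/eqP => sd; apply: neq; congr pair; last first.
    by rewrite -(card_leaves d_gt0 cplxK pureK) nl cards0.
  have arith (D n : nat) (th : int) : D%:Z + 2 = 2 * th + (2 * n)%N%:Z ->
    D = (2 * n)%N -> th = 1 by lia.
  exact: arith thE sd.
have arith (m a D n p : nat) (th : int) : (a + 2 * n < D + 2 + p)%N ->
  D%:Z + 2 = 2 * th + (2 * n)%N%:Z -> (m <= a)%N -> m%:Z <= 2 * th + p%:Z - 1 by lia.
rewrite -(card_leaves d_gt0 cplxK pureK).
exact: arith cS thE (multiplicity_le_forcing l0 fS).
Qed.
End Bound.

(** * Signed cycles and trigonometry *)

(** The angle is [2 pi / m] or [pi / m] according to the sign; the assumption on [m]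
keeps it below [pi]. *)
Lemma angle_exists (R : realType) m (sigma : R) : (2 < m)%N -> sigma * sigma = 1 ->
  exists phi : R, [/\ 0 < sin phi, cos (m%:R * phi) = sigma & sin (m%:R * phi) = 0].
Proof.
move=> m3 s2; have m0 : (0 : R) < m%:R by rewrite ltr0n; lia.
have [a [a0 am ca sa]] :
    exists a : R, [/\ 0 < a, a < m%:R * pi, cos a = sigma & sin a = 0].
  have : (sigma - 1) * (sigma + 1) = 0 by rewrite mulrBl mulrDr s2; ring.
  move/eqP; rewrite mulf_eq0 subr_eq0 addr_eq0 => /orP[]/eqP ->.
    exists (pi *+ 2); rewrite cos2pi sin2pi; split=> //.
      by rewrite pmulrn_rgt0 // pi_gt0.
    by rewrite -[pi *+ 2]mulr_natl ltr_pM2r ?pi_gt0 // ltr_nat.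
  exists pi; rewrite cospi sinpi; split=> //; first exact: pi_gt0.
  by rewrite ltr_pMl ?pi_gt0 // ltr1n; lia.
exists (a / m%:R); have -> : m%:R * (a / m%:R) = a by rewrite mulrC divfK ?gt_eqF.
split=> //.
by apply: sin_gt0_pi; rewrite divr_gt0 //= ltr_pdivrMr // mulrC.
Qed.

Section SignedCycle.
Variables (R : realType) (m : nat) (s : 'I_m -> R).
Hypotheses (m3 : (2 < m)%N) (s_sq : forall k, s k * s k = 1).

Let m_gt0 : (0 < m)%N. Proof. by lia. Qed.

(** Cyclic indices are lifted to [nat], where products and recurrences are plain. *)
Definition ord_mod (n : nat) : 'I_m := Ordinal (ltn_pmod n m_gt0).

Lemma ord_modK (k : 'I_m) : ord_mod k = k.
Proof. by apply: val_inj; rewrite /= modn_small. Qed.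

Lemma ord_modS n : ordS (ord_mod n) = ord_mod n.+1.
Proof. by apply: val_inj; rewrite /= -addn1 modnDml addn1. Qed.

Lemma ord_modDm n : ord_mod (n + m) = ord_mod n.
Proof. by apply: val_inj; rewrite /= modnDr. Qed.

(** Switching: multiplying the [k]-th coordinate by this sign makes all the signs
of the cycle equal to 1, except that going round once costs the product
[gauge m] of all of them. *)
Definition gauge (n : nat) : R := \prod_(j < n) s (ord_mod j).

Lemma gaugeS n : gauge n.+1 = gauge n * s (ord_mod n).
Proof. by rewrite /gauge big_ord_recr. Qed.

Lemma gaugeDm n : gauge (n + m) = gauge n * gauge m.
Proof.
elim: n => [|n IH]; first by rewrite add0n /gauge big_ord0 mul1r.
by rewrite addSn !gaugeS IH ord_modDm mulrAC.
Qed.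

Lemma gauge_sq n : gauge n * gauge n = 1.
Proof.
elim: n => [|n IH]; first by rewrite /gauge big_ord0 mul1r.
by rewrite gaugeS mulrACA IH s_sq mul1r.
Qed.

(** A sequence that follows the recurrence with signs 1 and picks up the factor
[gauge m] over one period gives, once switched, a vector on the signed cycle. *)
Lemma lift_recurrence mu (c : nat -> R) :
  (forall n, c n.+2 + c n = mu * c n.+1) ->
  (forall n, c (n + m)%N = gauge m * c n) ->
  let x (k : 'I_m) := gauge k * c k in
  forall k, s (ordS k) * x (ordS (ordS k)) + s k * x k = mu * x (ordS k).
Proof.
move=> crec cper x.
have xper n : x (ord_mod n) = gauge n * c n.
  rewrite /x /= [in RHS](divn_eq n m) addnC; elim: (n %/ m)%N => [|q IH].
    by rewrite mul0n addn0.
  rewrite mulSn [(m + _)%N]addnC addnA gaugeDm cper mulrA.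
  by rewrite -[_ * gauge m * gauge m]mulrA gauge_sq mulr1.
move=> k; rewrite -(ord_modK k) !ord_modS !xper.
rewrite [mu * _]mulrCA -crec !gaugeS mulrDr; congr (_ + _).
  by rewrite mulrCA mulrA; congr (_ * _); rewrite -!mulrA s_sq mulr1.
by rewrite mulrCA mulrA.
Qed.

(** The real and imaginary parts of the sequence of powers of [exp (i phi)] satisfy
the recurrence with [mu = 2 cos phi]. They are independent since [sin phi] is not 0,
and for the same reason [mu] is greater than [-2]. *)
Lemma signed_cycle_eigenvectors : exists mu (x1 x2 : 'I_m -> R),
  [/\ -2 < mu,
      forall k, s (ordS k) * x1 (ordS (ordS k)) + s k * x1 k = mu * x1 (ordS k),
      forall k, s (ordS k) * x2 (ordS (ordS k)) + s k * x2 k = mu * x2 (ordS k)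
    & forall a b, (forall k, a * x1 k + b * x2 k = 0) -> a = 0 /\ b = 0].
Proof.
have [phi [sphi cm sm]] := angle_exists m3 (gauge_sq m).
have addS n : n.+1%:R * phi = n%:R * phi + phi by rewrite -addn1 natrD mulrDl mul1r.
have subS n : n%:R * phi = n.+1%:R * phi - phi by rewrite addS addrK.
exists (cos phi *+ 2), (fun k => gauge k * cos (k%:R * phi)),
  (fun k => gauge k * sin (k%:R * phi)).
split.
- have := cos2Dsin2 phi; rewrite -mulr_natl !expr2 => E; nra.
- apply: (@lift_recurrence _ (fun n => cos (n%:R * phi))) => n.
    by rewrite [n.+2%:R * _]addS [n%:R * _]subS cosD cosB; ring.
  by rewrite natrD mulrDl cosD cm sm mulr0 subr0 mulrC.
- apply: (@lift_recurrence _ (fun n => sin (n%:R * phi))) => n.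
    by rewrite [n.+2%:R * _]addS [n%:R * _]subS sinD sinB; ring.
  by rewrite natrD mulrDl sinD cm sm mulr0 addr0 mulrC.
move=> a b ab.
have a0 : a = 0.
  have := ab (ord_mod 0); rewrite /= mod0n mul0r cos0 sin0 /gauge big_ord0.
  by rewrite !mulr1 !mulr0 addr0.
split=> //; have := ab (ord_mod 1); rewrite a0 mul0r add0r /= modn_small; last by lia.
rewrite mul1r => /eqP; rewrite !mulf_eq0 (gt_eqF sphi) orbF => /orP[/eqP //|/eqP g0].
by have := gauge_sq 1; rewrite g0 mul0r => /esym/eqP; rewrite oner_eq0.
Qed.
End SignedCycle.

Section CycleAttains.
Variables (R : realType) (V : finType) (K : {set {set V}}) (d : nat).
Variable (o : {set V} -> seq V).
Hypotheses (d_gt0 : (0 < d)%N) (cplxK : is_complex K) (pureK : pure K d).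
Hypothesis orient_o : is_orientation K o.
Implicit Types (F G H r s t : {set V}).

Local Notation bd := (boundary_coef R o).

Lemma sum_ridges_of_facet (g : {set V} -> R) G : G \in facets K ->
  (forall r, ~~ (r \subset G) -> g r = 0) ->
  \sum_(r in ridges K d) g r =
  \sum_(r in nonfree_in K d G) g r + \sum_(r in free_in K d G) g r.
Proof.
move=> GK g0; rewrite big_mkcond [X in _ = X + _]big_mkcond [X in _ = _ + X]big_mkcond.
rewrite -big_split; apply: eq_bigr => r _ /=.
rewrite [r \in nonfree_in _ _ _]in_set [r \in free_in _ _ _]in_set.
case: (boolP (r \subset G)) => [rG|/g0 ->]; last by rewrite !andbF !if_same addr0.
rewrite !andbT in_setD; case: (boolP (r \in free_ridges K d)) => [rf|rf] /=.
  by rewrite (free_ridge rf) add0r.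
by rewrite addr0.
Qed.

Lemma sum_facets_through (X : {set V} -> R) r :
  \sum_(F in facets K) X F * bd r F = \sum_(F in facets_through K r) X F * bd r F.
Proof.
rewrite big_mkcond [RHS]big_mkcond; apply: eq_bigr => F _.
rewrite in_facets_through; case: (boolP (F \in facets K)) => //= FK.
by case: (boolP (r \subset F)) => // rF; rewrite (facet_coef0 R pureK orient_o) ?mulr0.
Qed.

Variables (m : nat) (Fc Rc : 'I_m -> {set V}).
Hypotheses (m3 : (2 < m)%N) (F_inj : injective Fc) (R_inj : injective Rc).
Hypothesis F_im : [set Fc k | k : 'I_m] = facets K.
Hypothesis R_im : [set Rc k | k : 'I_m] = nonfree_ridges K d.
Hypothesis thr : forall k, facets_through K (Rc k) = [set Fc k; Fc (ordS k)].

(** The sign that couples the facets [Fc k] and [Fc (ordS k)] in the Gram matrix. *)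
Definition cycle_sign (k : 'I_m) : R := bd (Rc k) (Fc k) * bd (Rc k) (Fc (ordS k)).

Lemma cycle_facet k : Fc k \in facets K.
Proof. by rewrite -F_im imset_f. Qed.

Lemma cycle_coef_sq k : bd (Rc k) (Fc k) * bd (Rc k) (Fc k) = 1 /\
  bd (Rc k) (Fc (ordS k)) * bd (Rc k) (Fc (ordS k)) = 1.
Proof.
have rK : Rc k \in ridges K d by apply: nonfree_ridge; rewrite -R_im imset_f.
have sub F : F \in facets_through K (Rc k) -> Rc k \subset F.
  by rewrite in_facets_through => /andP[].
split; apply: (facet_coef_sq R d_gt0 pureK orient_o) => //; try exact: cycle_facet.
  by apply: sub; rewrite thr !inE eqxx.
by apply: sub; rewrite thr !inE eqxx orbT.
Qed.

Lemma cycle_sign_sq k : cycle_sign k * cycle_sign k = 1.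
Proof. by have [h1 h2] := cycle_coef_sq k; rewrite /cycle_sign mulrACA h1 h2 mulr1. Qed.

Definition on_cycle (x : 'I_m -> R) F := \sum_k x k * (Fc k == F)%:R.

Lemma on_cycleE x k : on_cycle x (Fc k) = x k.
Proof.
rewrite /on_cycle (bigD1 k) //= eqxx mulr1 big1 ?addr0 // => j jk.
by rewrite (inj_eq F_inj) (negPf jk) mulr0.
Qed.

(** The facet [Fc (ordS k)] gets one term from each of its [d - 1] free ridges, and
from each of its two nonfree ridges one term from itself and one from the
neighbour beyond. *)
Lemma cycle_gram mu x :
  (forall k, cycle_sign (ordS k) * x (ordS (ordS k)) + cycle_sign k * x k
    = mu * x (ordS k)) ->
  forall G, G \in facets K ->
  \sum_(r in ridges K d) (\sum_(F in facets K) on_cycle x F * bd r F) * bd r G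
    = (d%:R + 1 + mu) * on_cycle x G.
Proof.
move=> rec G GK; have : G \in [set Fc k | k : 'I_m] by rewrite F_im.
case/imsetP=> k' _ EG; rewrite {}EG -(ord_predK k') in GK *.
move: (ord_pred k') GK => {k'}k GK; rewrite on_cycleE.
rewrite (sum_ridges_of_facet GK) => [|r rG]; last first.
  by rewrite (facet_coef0 R pureK orient_o) ?mulr0.
rewrite [X in _ + X](eq_bigr (fun=> x (ordS k))) => [|r]; last first.
  rewrite in_set => /andP[rfree rG]; rewrite sum_facets_through.
  have Gr : Fc (ordS k) \in facets_through K r by rewrite in_facets_through GK.
  have := rfree; rewrite inE => /andP[rK /cards1P[H EH]].
  rewrite EH in_set1 in Gr; rewrite EH big_set1 -(eqP Gr) on_cycleE -mulrA.
  by rewrite (facet_coef_sq R d_gt0 pureK orient_o) ?mulr1.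
have nfE := cycle_nonfree_in F_inj R_im thr (ordS k).
have nf2 := cycle_card_nonfree_in m3 F_inj R_inj R_im thr (ordS k).
have freeE : #|free_in K d (Fc (ordS k))| = d.-1.
  by have := card_free_nonfree d_gt0 cplxK pureK GK; rewrite nf2; lia.
rewrite sumr_const freeE nfE ordSK.
have SkNk j : ordS j != j := ordS_neq j (ltnW m3).
have atR j : \sum_(F in facets K) on_cycle x F * bd (Rc j) F =
    x j * bd (Rc j) (Fc j) + x (ordS j) * bd (Rc j) (Fc (ordS j)).
  rewrite sum_facets_through thr big_setU1 ?big_set1 ?on_cycleE //.
  by rewrite inE (inj_eq F_inj) eq_sym.
rewrite big_setU1; last by rewrite inE (inj_eq R_inj).
rewrite big_set1 2!atR.
have [h1 h2] := cycle_coef_sq (ordS k); have [h3 h4] := cycle_coef_sq k.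
have := rec k; rewrite /cycle_sign.
have -> : d%:R = d.-1%:R + 1 :> R by rewrite -[in LHS](prednK d_gt0) -addn1 natrD.
move=> E; rewrite [RHS]mulrDl -E /=.
have arith (a1 a2 b1 b2 y0 y1 y2 D : R) : a1 * a1 = 1 -> b2 * b2 = 1 ->
    (y1 * a1 + y2 * a2) * a1 + (y0 * b1 + y1 * b2) * b2 + D * y1 =
    (D + 1 + 1) * y1 + (a1 * a2 * y2 + b1 * b2 * y0).
  move=> a1a1 b2b2; transitivity
    (a1 * a1 * y1 + b2 * b2 * y1 + D * y1 + (a1 * a2 * y2 + b1 * b2 * y0)); first by ring.
  by rewrite a1a1 b2b2; ring.
by rewrite -[_ *+ d.-1]mulr_natl arith.
Qed.

(** Since [mu] is greater than [-2] and [d >= 1], the eigenvalue [d + 1 + mu] is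
positive. *)
Lemma cycle_multiplicity_ge2 : exists lambda : R,
  0 < lambda /\ (2 <= multiplicity o K d.-1 lambda)%N.
Proof.
have [mu [x1 [x2 [mu_gt eig1 eig2 indep]]]] := signed_cycle_eigenvectors m3 cycle_sign_sq.
have l0 : 0 < d%:R + 1 + mu.
  have : (1 : R) <= d%:R by rewrite ler1n.
  lra.
exists (d%:R + 1 + mu); split=> //.
pose x (i : 'I_2) := if i == 0 then x1 else x2.
pose X : 'M[R]_(2, #|faces K d.-1.+1|) := \matrix_(i, j) on_cycle (x i) (enum_val j).
apply: (eigenspace_gram_ge (X := X)); first by rewrite gt_eqF.
  rewrite -kermx_eq0; apply/rowV0P => v /sub_kermxP/rowP vX.
  have [|v0 v1] := indep (v 0 0) (v 0 1).
    move=> k; have FK : Fc k \in faces K d.-1.+1.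
      by rewrite prednK // -(facets_faces pureK) cycle_facet.
    have := vX (enum_rank_in FK (Fc k)).
    rewrite !mxE !big_ord_recl big_ord0 addr0 !mxE enum_rankK_in // !on_cycleE.
    by rewrite (_ : lift _ _ = 1) //; apply: val_inj.
  apply/rowP => i; rewrite [RHS]mxE; case: i => [[|[|//]] p].
    by rewrite -[RHS]v0; congr (v _ _); apply: val_inj.
  by rewrite -[RHS]v1; congr (v _ _); apply: val_inj.
apply/matrixP => i b; rewrite mulmxA mxE [RHS]mxE [X i b]mxE.
have bK : enum_val b \in facets K.
  by rewrite (facets_faces pureK) -{2}(prednK d_gt0) enum_valP.
rewrite -(cycle_gram (mu := mu)) //; last by rewrite /x; case: ifP.
rewrite -(sum_ridge_index K d (fun r =>
  (\sum_(F in facets K) on_cycle (x i) F * bd r F) * bd r (enum_val b))).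
apply: eq_bigr => a _; rewrite mxE [boundary _ _ _ _ a b]mxE; congr (_ * _).
rewrite -(sum_facet_index d_gt0 pureK (fun F => on_cycle (x i) F * bd _ F)).
by apply: eq_bigr => c _; rewrite !mxE.
Qed.

End CycleAttains.

(** * The bound and its equality case *)

Theorem theorem3 (R : realType) (V : finType) (K : {set {set V}}) (d : nat)
    (o : {set V} -> seq V)
    (d_ge1 : (1 <= d)%N)
    (cplxK : is_complex K) (pureK : pure K d) (connK : ridge_connected K d)
    (two_facets : (2 <= #|facets K|)%N)
    (orient_o : is_orientation K o) :
  [/\ forall lambda : R, 0 < lambda ->
        eigenvalue (up_laplacian R o K d.-1) lambda ->
        (multiplicity o K d.-1 lambda)%:Z
          <= 2 * theta K d + #|pendant_facets K d|%:Z,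
      (theta K d, #|pendant_facets K d|) <> (1, 0%N) ->
        forall lambda : R, 0 < lambda ->
        eigenvalue (up_laplacian R o K d.-1) lambda ->
        (multiplicity o K d.-1 lambda)%:Z
          <= 2 * theta K d + #|pendant_facets K d|%:Z - 1,
      (exists lambda : R,
         [/\ 0 < lambda, eigenvalue (up_laplacian R o K d.-1) lambda
           & (multiplicity o K d.-1 lambda)%:Z
               = 2 * theta K d + #|pendant_facets K d|%:Z])
        <-> simplicial_cycle K d
    & simplicial_cycle K d
        <-> (theta K d, #|pendant_facets K d|) = (1, 0%N)].
Proof.
have cycleE := cycle_iff d_ge1 cplxK pureK connK two_facets.
have bound := multiplicity_le d_ge1 cplxK pureK orient_o connK two_facets.
have strict := multiplicity_lt d_ge1 cplxK pureK orient_o connK two_facets.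
split=> //; first by move=> lambda l0 _; apply: bound.
  by move=> neq lambda l0 _; apply: strict.
split=> [[lambda [l0 _ multE]]|cyc].
  apply/cycleE/eqP/negPn/negP => /eqP neq.
  by have := strict R lambda l0 neq; rewrite multE; lia.
have [theta1 p0] := cycleE.1 cyc.
case: cyc => m [F [r [m3 [F_inj F_im] [r_inj r_im] _ thr]]].
have [lambda [l0 mult2]] := cycle_multiplicity_ge2 R d_ge1 cplxK pureK orient_o
  m3 F_inj r_inj F_im r_im thr.
exists lambda; split=> //.
  by rewrite /eigenvalue -mxrank_eq0 -lt0n; apply: leq_trans mult2.
by have := bound R lambda l0; rewrite theta1 p0; lia.
Qed.
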